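(* Let $d\in\mathbb{N}$, $\Omega=\{1,2,\ldots,d\}^{\mathbb{N}}$, let $g:\Omega\to\mathbb{R}$ be a Hölder potential and $\beta>0$. Then any quadratic mean-field equilibrium probability for the pair $g,\beta$ is $T$-invariant and lies in the (weak$^*$) closed convex hull of the set of quadratic equilibrium probabilities for $g$ (with parameter $\beta$). In particular, if there is a non-ergodic quadratic mean-field equilibrium probability for $g,\beta$, then the quadratic equilibrium probability for $g$ is non-unique, i.e. a nonlinear phase transition takes place.
   Context: $T:\Omega\to\Omega$ is the shift $T(x_1,x_2,\ldots)=(x_2,x_3,\ldots)$; $\Omega$ carries the metric $d(x,y)=2^{-\min\{n:\,x_n\neq y_n\}}$, and ''Hölder'' refers to this metric. $\mathcal{P}(T)$ is the set of $T$-invariant Borel probabilities on $\Omega$, with the weak$^*$ topology; $h(\rho)$ is the Kolmogorov-Sinai entropy; $\rho(g)=\int g\,\mathrm{d}\rho$. $\mu$ is the maximal entropy probability (the product measure with uniform marginals). For $\varphi\in C(\Omega)$ the Birkhoff averages are $\varphi_n=\frac1n(\varphi+\varphi\circ T+\cdots+\varphi\circ T^{n-1})$. For $n\in\mathbb{N}$ define the probability $\mathfrak{M}^{(n)}$ on $\Omega$ by $$\mathfrak{M}^{(n)}(\psi)=\frac{\int\psi_n(x)\,e^{\frac{\beta n}{2}g_n(x)^2}\,\mu(\mathrm{d}x)}{\int e^{\frac{\beta n}{2}g_n(x)^2}\,\mu(\mathrm{d}x)},\qquad\psi\in C(\Omega).$$ A quadratic mean-field equilibrium probability for $g,\beta$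 is any weak$^*$ limit of a convergent subsequence $\mathfrak{M}^{(n_k)}$, $k\to\infty$. A quadratic equilibrium probability for $g$ (with parameter $\beta$) is any $\rho\in\mathcal{P}(T)$ attaining $\sup_{\rho\in\mathcal{P}(T)}\{\frac{\beta}{2}\rho(g)^2+h(\rho)\}$. A nonlinear phase transition takes place if there is more than one such maximizer. *)

(* Defs.v *)
From HB Require Import structures.
From mathcomp Require Import all_boot all_order all_algebra.
From mathcomp Require Import all_classical all_reals all_analysis.

Set Implicit Arguments.
Unset Strict Implicit.
Unset Printing Implicit Defensive.

Import Order.TTheory GRing.Theory Num.Theory.
Import numFieldNormedType.Exports.

Local Open Scope classical_set_scope.
Local Open Scope ring_scope.

(** The alphabet has [m.+1] letters, so the [d >= 1] of the mathematics is
    [m.+1]: a measurable type of the library must be inhabited. Sequences are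
    indexed from 0, i.e. [x n] is the coordinate $x_{n+1}$. *)
Definition Omega (m : nat) : Type :=
  prod_topology (fun _ : nat => discrete_topology 'I_m.+1).

HB.instance Definition _ m := Topological.on (Omega m).
HB.instance Definition _ m := isPointed.Build (Omega m) (fun=> ord0).

HB.instance Definition _ m :=
  Measurable.copy (Omega m) (g_sigma_algebraType (@open (Omega m))).

Definition left_shift (m : nat) (x : Omega m) : Omega m := fun n => x n.+1.

Section metric.
Variables (R : realType) (m : nat).
Implicit Types x y : Omega m.

Definition differ x y : pred nat := fun n => x n != y n.

(** The exponent is the first differing position counted from 1. *)
Definition seq_dist x y : R :=
  if pselect (exists n, differ x y n) is left xy then 2 ^- (ex_minn xy).+1
  else 0.

Definition hoelder_continuous (g : Omega m -> R) : Prop :=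
  exists a C : R, [/\ 0 < a, 0 <= C &
    forall x y, `|g x - g y| <= C * seq_dist x y `^ a].

Lemma seq_dist_lt x y N :
  seq_dist x y < 2 ^- N <-> forall n, (n < N)%N -> x n = y n.
Proof.
have p2 k : 0 < 2 ^+ k :> R by rewrite exprn_gt0.
rewrite /seq_dist; case: pselect => [xy|xy].
  case: ex_minnP => k xyk kmin; rewrite ltf_pV2 ?posrE// ltr_eXn2l ?ltr1n//.
  rewrite ltnS; split=> [Nk n nN|H].
    apply/eqP/negPn/negP => /kmin kn.
    by have := leq_trans (leq_trans nN Nk) kn; rewrite ltnn.
  by rewrite leqNgt; apply/negP => /H /eqP; apply/negP.
rewrite invr_gt0 p2; split=> // _ n _; apply/eqP/negPn/negP => xyn.
by apply: xy; exists n.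
Qed.

(** The product topology is the topology of the metric [seq_dist]. *)
Lemma nbhs_seq_dist x (A : set (Omega m)) :
  nbhs x A <-> exists2 e : R, 0 < e & forall y, seq_dist x y < e -> A y.
Proof.
split=> [xA|[e e0 xeA]].
  pose F : set_system (Omega m) :=
    filter_from [set e : R | 0 < e] (fun e => [set y | seq_dist x y < e]).
  have FF : Filter F.
    apply: filter_from_filter; first by exists 1 => /=.
    move=> i j /= i0 j0; exists (Num.min i j); first by rewrite /= lt_min i0.
    by move=> y /=; rewrite lt_min => /andP[].
  suff : F --> x by move=> /(_ _ xA)[e e0 H]; exists e => // y; exact: H.
  apply/cvg_sup => n B [_ [[U _ <-] Uxn UB]].
  exists (2 ^- n.+1) => /=; first by rewrite invr_gt0 exprn_gt0.
  by move=> y /seq_dist_lt/(_ n (ltnSn _)) xy; apply: UB => /=; rewrite -xy.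
have [N Ne] : exists N, 2 ^- N < e :> R.
  exists (Num.truncn e^-1).+1; rewrite -[ltRHS]invrK ltf_pV2 ?posrE ?invr_gt0//.
    apply: (lt_le_trans (truncnS_gt _)).
    by rewrite -natrX ler_nat; apply/ltnW/ltn_expl.
have nx n : nbhs x [set y : Omega m | x n = y n].
  have xn : nbhs (x n) [set x n] by exact: discrete_set1.
  have := @proj_continuous nat (fun=> discrete_topology 'I_m.+1) n x _ xn.
  by apply: (@filterS _ (nbhs x)) => y /= yn; exact: esym yn.
apply: (@filterS _ (nbhs x) _ (\bigcap_(n in [set n | (n < N)%N])
    [set y : Omega m | x n = y n])).
  by move=> y H; apply/xeA/(lt_trans _ Ne)/seq_dist_lt.
elim: N {Ne} => [|N IH]; first by apply: (@filterS _ (nbhs x)) filterT.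
apply: (@filterS _ (nbhs x)) (filterI IH (nx N)) => y [H yN] n /=.
by rewrite ltnS leq_eqVlt => /predU1P[->//|]; exact: H.
Qed.

End metric.

Section dynamics.
Context {d : measure_display} {X : measurableType d} {R : realType}.
Variable T : X -> X.
Implicit Type rho : probability X R.

Definition birkhoff (phi : X -> R) (n : nat) (x : X) : R :=
  n%:R^-1 * \sum_(i < n) phi (iter i T x).

Definition invariant_prob rho : Prop :=
  forall A, measurable A -> rho (T @^-1` A) = rho A.

Definition ergodic_prob rho : Prop :=
  forall A, measurable A -> T @^-1` A = A -> rho A = 0%E \/ rho A = 1%E.

Definition measurable_partition (k : nat) (A : 'I_k -> set X) : Prop :=
  [/\ forall i, measurable (A i), trivIset setT A & \bigcup_i A i = setT].

(** atoms of the join of the partitions $T^{-i} A$, $i < n$ *)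
Definition join_atom (k : nat) (A : 'I_k -> set X) (n : nat)
    (w : {ffun 'I_n -> 'I_k}) : set X :=
  \bigcap_(i in [set: 'I_n]) (iter i T @^-1` A (w i)).

(** [ln 0 = 0] gives the usual convention on atoms of measure zero. *)
Definition join_entropy rho (k : nat) (A : 'I_k -> set X) (n : nat) : R :=
  - \sum_(w : {ffun 'I_n -> 'I_k})
      fine (rho (join_atom A w)) * ln (fine (rho (join_atom A w))).

(** For invariant [rho] the limit exists by subadditivity. *)
Definition partition_entropy rho (k : nat) (A : 'I_k -> set X) : R :=
  limn (fun n => n%:R^-1 * join_entropy rho A n).

Definition ks_entropy rho : \bar R :=
  ereal_sup [set h | exists k (A : 'I_k -> set X),
    measurable_partition A /\ h = (partition_entropy rho A)%:E].

End dynamics.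

Section weak_star.
Context {R : realType} {m : nat}.
Local Notation C := (continuousType (Omega m) R).

Definition expectation_on_C (rho : probability (Omega m) R) : {ptws C -> R} :=
  fun psi => \int[rho]_x psi x.

Definition convex_hull (S : set (probability (Omega m) R)) :
    set (probability (Omega m) R) :=
  [set nu | exists (k : nat) (w : 'I_k -> R)
      (rho : 'I_k -> probability (Omega m) R),
    [/\ forall i, 0 <= w i, \sum_i w i = 1, forall i, S (rho i) &
      forall A, measurable A -> nu A = (\sum_i (w i)%:E * rho i A)%E]].

(** [{ptws C -> R}] carries pointwise convergence on continuous functions, so
    this initial topology is the weak* one. *)
Definition closed_convex_hull (S : set (probability (Omega m) R)) :
    set (probability (Omega m) R) :=
  closure (convex_hull S : set (initial_topology expectation_on_C)).

End weak_star.

Section quadratic.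
Context {R : realType} {m : nat}.
Implicit Types (rho nu mu : probability (Omega m) R) (g : Omega m -> R).

(** The values on finite-dimensional rectangles determine the measure. *)
Definition uniform_product mu : Prop :=
  forall (n : nat) (A : 'I_n -> {set 'I_m.+1}),
    mu [set x : Omega m | forall i : 'I_n, x i \in A i] =
    (\prod_(i < n) (#|A i|%:R / m.+1%:R))%:E.

(** The probability $\mathfrak{M}^{(n)}$, as a functional on continuous
    functions; its limits are taken weak*, i.e. pointwise in [psi]. *)
Definition mean_field mu g (beta : R) (n : nat) :
    {ptws continuousType (Omega m) R -> R} :=
  let weight x := expR (beta * n%:R / 2 * birkhoff (@left_shift m) g n x ^+ 2) in
  fun psi => (\int[mu]_x (birkhoff (@left_shift m) psi n x * weight x)) /
             (\int[mu]_x weight x).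

Definition mean_field_equilibrium mu g (beta : R) nu : Prop :=
  exists2 s : nat -> nat, {homo s : i j / (i < j)%N} &
    mean_field mu g beta (s k) @[k --> \oo] --> expectation_on_C nu.

Definition quadratic_pressure g (beta : R) rho : \bar R :=
  ((beta / 2 * (\int[rho]_x g x) ^+ 2)%:E + ks_entropy (@left_shift m) rho)%E.

Definition quadratic_equilibrium g (beta : R) :
    set (probability (Omega m) R) :=
  [set rho | invariant_prob (@left_shift m) rho /\
    quadratic_pressure g beta rho = ereal_sup
      [set quadratic_pressure g beta nu | nu in invariant_prob (@left_shift m)]].

(** Leibniz equality would also compare the values on non-Borel sets. *)
Definition nonlinear_phase_transition g (beta : R) : Prop :=
  exists rho1 rho2, [/\ quadratic_equilibrium g beta rho1,
    quadratic_equilibrium g beta rho2 &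
    exists2 A, measurable A & rho1 A <> rho2 A].

End quadratic.

(* Main.v *)
Require Import Defs.
From HB Require Import structures.
From mathcomp Require Import all_boot all_order all_algebra.
From mathcomp Require Import all_classical all_reals all_analysis.
From mathcomp Require Import measurable_realfun.
From mathcomp Require Import zify ring lra.
Import Order.TTheory GRing.Theory Num.Theory.
Import numFieldNormedType.Exports.
Local Open Scope classical_set_scope.
Local Open Scope ring_scope.

(** The proof is variational. Call $\frac\beta2\rho(g)^2+h(\rho)$ the free energy
    of an invariant probability $\rho$, let $Z_n$ be the normalising integral of
    $\mathfrak M^{(n)}$, and let $d$ be the number of letters. The heart of the
    matter is [exists_maximizer_ge]: for every mean-field limit $\nu$ and every
    continuous $\psi$ some maximizer $\rho$ of the free energy has
    $\nu(\psi)\le\rho(\psi)$. It rests on two estimates.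

    From above, the free energy of any invariant probability is at most
    $\ln d+\frac1n\ln Z_n+o(1)$ ([partition_entropy_pressure]). The tangent line
    of the square at $\rho(g)$ replaces the quadratic weight by a linear one, and
    for that one the bound is Gibbs' inequality
    $H(p)+\sum pV\le\ln\sum e^V$ on words.

    From below, cut the space according to the value of the Birkhoff average
    $g_n$, in steps of $1/n$. As there are only $O(n)$ cells, one of them carries a
    fraction of the mass of $\mathfrak M^{(n)}$ that is not exponentially small,
    and at the same time gives $\psi_n$ a conditional mean at least
    $\mathfrak M^{(n)}(\psi)-\frac1n$. On that cell $g_n$ is nearly constant, so
    that the quadratic weight can be pulled out and the entropy of the first $n$
    letters is at least $\ln d+\frac1n\ln Z_n-\frac\beta2(\text{mean of
    }g_n)^2-o(1)$ per letter ([mean_field_cell]). Averaging along orbits transfers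
    this to blocks of fixed length ([entropy_block_average]), and a limit along an
    ultrafilter is an invariant probability $\rho$ with $\rho(\psi)\ge\nu(\psi)$
    and, by the first estimate, with maximal free energy.

    The conditioned weights, their orbit averages and the limit are handled as
    states, positive normalised functionals on bounded measurable functions. On
    the sequence space clopen sets are compact, so that a state is represented by
    a probability on continuous functions ([state_representation]).

    The two claims follow. A point that no continuous function separates from the
    set of maximizers lies in its closed convex hull; as a weak-star neighbourhood
    involves finitely many functions, this is a separation argument in finite
    dimension ([convex_hull_approx]). If the maximizer is unique, testing $\psi$
    and $-\psi$ identifies $\nu$ with it, and it is ergodic, because splitting it
    along an invariant set would produce two different maximizers
    ([unique_maximizer_ergodic]). *)

(** * Gibbs' inequality and subadditive sequences *)

Section finite_gibbs.
Context {R : realType}.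

(** This is $\ln y\le y-1$ at $y=q/p$. Read as a statement about $p$ it is the
    supporting line at $q$ of the concave function $-p\ln p$, which is how
    upper semicontinuity of the entropy uses it. *)
Lemma ln_gap_le (p q : R) : 0 <= p -> 0 <= q -> (0 < p -> 0 < q) ->
  p * (ln q - ln p) <= q - p.
Proof.
rewrite le_eqVlt => /predU1P[<- q0 _|p0 _ /(_ p0) q0].
  by rewrite mul0r subr0.
rewrite -ln_div ?posrE//.
have pq : 0 < q / p by rewrite divr_gt0.
have := @le_ln1Dx R (q / p - 1); rewrite ltrBrDl subrr => /(_ pq).
rewrite subrKC -(ler_pM2l p0) => /le_trans; apply.
by rewrite mulrBr mulr1 mulrC divfK ?gt_eqF.
Qed.

Lemma entropy_le_cross (K : finType) (p q : K -> R) :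
  (forall a, 0 <= p a) -> (forall a, 0 <= q a) ->
  \sum_a q a <= \sum_a p a -> (forall a, 0 < p a -> 0 < q a) ->
  - (\sum_a p a * ln (p a)) <= - (\sum_a p a * ln (q a)).
Proof.
move=> p0 q0 qp pq; rewrite lerN2 -subr_le0 -sumrB.
apply: (@le_trans _ _ (\sum_a (q a - p a))).
  by apply: ler_sum => a _; rewrite -mulrBr ln_gap_le//; exact: pq.
by rewrite sumrB subr_le0.
Qed.

(** Cross entropy against the Gibbs law $e^{V}/\sum e^{V}$. With a suitable $V$
    this inequality replaces the theory of conditional entropy and of
    generators. *)
Lemma gibbs_variational (K : finType) (p V : K -> R) :
  (forall a, 0 <= p a) -> \sum_a p a = 1 ->
  - (\sum_a p a * ln (p a)) + \sum_a p a * V a <= ln (\sum_a expR (V a)).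
Proof.
move=> p0 p1; set S := \sum_a expR (V a).
have S0 : 0 < S.
  rewrite /S lt_def sumr_ge0 ?andbT//.
  rewrite psumr_eq0; last by move=> a _; exact: expR_ge0.
  apply/negP => /allP Sz; have : \sum_a p a = 0.
    by rewrite big1// => a _; have := Sz a (mem_index_enum a); rewrite /= expR_eq0.
  by move/eqP; rewrite p1 oner_eq0.
have := @entropy_le_cross K p (fun a => expR (V a) / S) p0.
move=> /(_ (fun a => divr_ge0 (expR_ge0 _) (ltW S0))).
rewrite -mulr_suml divff ?gt_eqF// p1 => /(_ (lexx _)).
move=> /(_ (fun a _ => divr_gt0 (expR_gt0 _) S0)).
rewrite -lerBrDr => /le_trans; apply; rewrite lerNl opprB.
rewrite -[ln S]mul1r -p1 mulr_suml -sumrB ler_sum// => a _.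
by rewrite -mulrBr ln_div ?posrE ?expR_gt0// expRK.
Qed.

End finite_gibbs.

Section fekete.
Context {R : realType}.
Variable u : nat -> R.
Hypothesis u0 : forall n, 0 <= u n.
Hypothesis usub : forall n l, u (n + l)%N <= u n + u l.

Let umul q k : u (k * q)%N <= k%:R * u q + u 0%N.
Proof.
elim: k => [|k IH]; first by rewrite mul0n mul0r add0r.
rewrite mulSn (le_trans (usub _ _))// -natr1 mulrDl mul1r; have := IH; lra.
Qed.

Let slopes := [set n.+1%:R^-1 * u n.+1 | n in [set: nat]].

Let slopes_inf : has_inf slopes.
Proof.
split; first by exists (1%:R^-1 * u 1%N), 0%N.
by exists 0 => _ [n _ <-]; rewrite mulr_ge0// invr_ge0.
Qed.

Lemma fekete_le n : (0 < n)%N -> inf slopes <= n%:R^-1 * u n.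
Proof.
case: n => // n _; apply: ge_inf; last by exists n.
by case: slopes_inf.
Qed.

(** Dividing $n$ by a length $Q$ whose slope $u_Q/Q$ is nearly minimal gives
    $u_n\le n\,u_Q/Q+C$ with $C$ independent of $n$. *)
Lemma fekete_cvg : n%:R^-1 * u n @[n --> \oo] --> inf slopes.
Proof.
apply/cvgrPdist_le => e e0.
have e20 : 0 < e / 2 by rewrite divr_gt0.
have [_ [q _ <-] qe] := inf_adherent e20 slopes_inf.
set Q := q.+1 in qe *.
pose C := Q%:R * u 1%N + 2 * u 0%N.
have C0 : 0 <= C by rewrite addr_ge0// mulr_ge0.
near=> n.
have n0 : (0 < n)%N by near: n; exists 1%N.
have n0R : 0 < n%:R :> R by rewrite ltr0n.
rewrite distrC ger0_norm ?subr_ge0 ?fekete_le//.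
suff : n%:R^-1 * u n <= Q%:R^-1 * u Q + e / 2 by lra.
have un : u n <= n%:R * (Q%:R^-1 * u Q) + C.
  rewrite {1}(divn_eq n Q) (le_trans (usub _ _))//.
  have h1 := umul Q (n %/ Q).
  have h2 : u (n %% Q)%N <= Q%:R * u 1%N + u 0%N.
    have := umul 1 (n %% Q); rewrite muln1 => /le_trans; apply.
    by rewrite lerD2r ler_wpM2r// ler_nat ltnW// ltn_mod.
  have h3 : (n %/ Q)%:R * u Q <= n%:R * (Q%:R^-1 * u Q).
    rewrite mulrA ler_wpM2r// ler_pdivlMr ?ltr0n// -natrM ler_nat.
    exact: leq_divM.
  rewrite /C; lra.
have : C / n%:R <= e / 2.
  rewrite ler_pdivrMr// -ler_pdivrMl//.
  near: n; exact: nbhs_infty_ger.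
have -> : Q%:R^-1 * u Q = n%:R^-1 * (n%:R * (Q%:R^-1 * u Q)).
  by rewrite mulKf ?gt_eqF.
move=> h; rewrite -(ler_pM2l n0R) mulVKf ?gt_eqF//.
rewrite mulrDr mulVKf ?gt_eqF//.
rewrite (le_trans un)// lerD2l.
by rewrite -ler_pdivrMl// mulrC.
Unshelve. all: by end_near. Qed.

End fekete.

(** * States on bounded measurable functions *)

Section bounded_measurable.
Context {d : measure_display} {X : measurableType d} {R : realType}.
Implicit Types (f g : X -> R).

Definition bounded_measurable f :=
  measurable_fun setT f /\ exists M : R, forall x, `|f x| <= M.

Lemma bounded_measurable_cst c : bounded_measurable (fun=> c).
Proof. by split; [exact: measurable_cst|exists `|c|]. Qed.

Lemma bounded_measurableD f g : bounded_measurable f -> bounded_measurable g ->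
  bounded_measurable (fun x => f x + g x).
Proof.
move=> [mf [M fM]] [mg [N gN]]; split; first exact: measurable_funD.
by exists (M + N) => x; rewrite (le_trans (ler_normD _ _))// lerD.
Qed.

Lemma bounded_measurableM f g : bounded_measurable f -> bounded_measurable g ->
  bounded_measurable (fun x => f x * g x).
Proof.
move=> [mf [M fM]] [mg [N gN]]; split; first exact: measurable_funM.
by exists (M * N) => x; rewrite normrM ler_pM.
Qed.

Lemma bounded_measurableZ c f : bounded_measurable f ->
  bounded_measurable (fun x => c * f x).
Proof. exact/bounded_measurableM/bounded_measurable_cst. Qed.

Lemma bounded_measurable_sum (I : Type) (r : seq I) (P : pred I)
    (F : I -> X -> R) : (forall i, bounded_measurable (F i)) ->
  bounded_measurable (fun x => \sum_(i <- r | P i) F i x).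
Proof.
move=> mF; elim: r => [|i r IH].
  by under eq_fun do rewrite big_nil; exact: bounded_measurable_cst.
under eq_fun do rewrite big_cons.
by case: (P i); [exact: bounded_measurableD|].
Qed.

Lemma bounded_measurable_comp (T : X -> X) f : measurable_fun setT T ->
  bounded_measurable f -> bounded_measurable (fun x => f (T x)).
Proof.
by move=> mT [mf [M fM]]; split; [exact: measurableT_comp|exists M].
Qed.

Lemma bounded_measurable_expR f : bounded_measurable f ->
  bounded_measurable (fun x => expR (f x)).
Proof.
move=> [mf [M fM]]; split; first exact: measurableT_comp.
exists (expR M) => x; rewrite ger0_norm ?expR_ge0// ler_expR.
exact: le_trans (ler_norm _) (fM x).
Qed.

Lemma measurable_iter (T : X -> X) n : measurable_fun setT T ->
  measurable_fun setT (iter n T).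
Proof.
by move=> mT; elim: n => [|n IH]; [exact: measurable_id|exact: measurableT_comp].
Qed.

Lemma bounded_measurable_iter (T : X -> X) f n : measurable_fun setT T ->
  bounded_measurable f -> bounded_measurable (fun x => f (iter n T x)).
Proof. by move=> mT; exact/bounded_measurable_comp/measurable_iter. Qed.

Lemma bounded_measurable_birkhoff (T : X -> X) f n : measurable_fun setT T ->
  bounded_measurable f -> bounded_measurable (birkhoff T f n).
Proof.
move=> mT mf; apply: bounded_measurableZ; apply: bounded_measurable_sum => i.
exact: bounded_measurable_iter.
Qed.

Lemma bounded_measurable_integrable (mu : probability X R) f :
  bounded_measurable f -> mu.-integrable setT (EFin \o f).
Proof.
move=> [mf [M fM]]; apply: measurable_bounded_integrable => //.
  by apply: le_lt_trans (ltry (1 : R)); rewrite -(probability_setT mu).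
exists M; split; first by rewrite num_real.
by move=> y My x _ /=; rewrite (le_trans (fM x))// ltW.
Qed.

End bounded_measurable.

Section state.
Context {d : measure_display} {X : measurableType d} {R : realType}.
Implicit Types (f g : X -> R) (J : (X -> R) -> R).

(** A finitely additive probability, seen as a functional. Conditioning on a set,
    averaging along orbits and passing to an ultralimit all stay among states,
    so a measure has to be constructed only once, from the final state. *)
Record state J : Prop := State {
  state1 : J (fun=> 1) = 1 ;
  stateD : forall f g, bounded_measurable f -> bounded_measurable g ->
    J (fun x => f x + g x) = J f + J g ;
  stateZ : forall c f, bounded_measurable f -> J (fun x => c * f x) = c * J f ;
  state_le : forall f g, bounded_measurable f -> bounded_measurable g ->
    (forall x, f x <= g x) -> J f <= J g }.

Section theory.
Variable J : (X -> R) -> R.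
Hypothesis hJ : state J.

Lemma state_cst c : J (fun=> c) = c.
Proof.
have -> : (fun=> c) = (fun x : X => c * 1) by apply/funext => x; rewrite mulr1.
by rewrite (stateZ _ hJ) ?(state1 _ hJ) ?mulr1//; exact: bounded_measurable_cst.
Qed.

Lemma state_sum (I : Type) (r : seq I) (F : I -> X -> R) :
  (forall i, bounded_measurable (F i)) ->
  J (fun x => \sum_(i <- r) F i x) = \sum_(i <- r) J (F i).
Proof.
move=> mF; elim: r => [|i r IH].
  by under eq_fun do rewrite big_nil; rewrite big_nil state_cst.
under eq_fun do rewrite big_cons.
by rewrite big_cons (stateD _ hJ)// ?IH//; exact: bounded_measurable_sum.
Qed.

Lemma stateB f g : bounded_measurable f -> bounded_measurable g ->
  J (fun x => f x - g x) = J f - J g.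
Proof.
move=> mf mg; have -> : (fun x => f x - g x) = (fun x => f x + -1 * g x).
  by apply/funext => x; rewrite mulN1r.
rewrite (stateD _ hJ)// ?(stateZ _ hJ)// ?mulN1r//.
exact: bounded_measurableZ.
Qed.

Lemma state_bound f M : bounded_measurable f -> (forall x, `|f x| <= M) ->
  `|J f| <= M.
Proof.
move=> mf fM; rewrite ler_norml; apply/andP; split.
  rewrite -(state_cst (- M)); apply: (state_le _ hJ) => //.
    exact: bounded_measurable_cst.
  by move=> x; have := fM x; rewrite ler_norml => /andP[].
rewrite -[leRHS]state_cst; apply: (state_le _ hJ) => //.
  exact: bounded_measurable_cst.
by move=> x; have := fM x; rewrite ler_norml => /andP[].
Qed.

Lemma state_dist f g e : bounded_measurable f -> bounded_measurable g ->
  (forall x, `|f x - g x| <= e) -> `|J f - J g| <= e.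
Proof.
move=> mf mg fg; rewrite -stateB//; apply: state_bound => //.
have -> : (fun x => f x - g x) = (fun x => f x + -1 * g x).
  by apply/funext => x; rewrite mulN1r.
exact/bounded_measurableD/bounded_measurableZ.
Qed.

Lemma state_ge0 f : bounded_measurable f -> (forall x, 0 <= f x) -> 0 <= J f.
Proof.
move=> mf f0; rewrite -(state_cst 0).
by apply: (state_le _ hJ) => //; exact: bounded_measurable_cst.
Qed.

End theory.

Lemma state_prob (rho : probability X R) : state (fun f => \int[rho]_x f x).
Proof.
split.
- by rewrite Rintegral_cst//= probability_setT mulr1.
- by move=> f g mf mg; rewrite RintegralD//; exact: bounded_measurable_integrable.
- by move=> c f mf; rewrite RintegralZl//; exact: bounded_measurable_integrable.
- by move=> f g mf mg fg; rewrite le_Rintegral//;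
    exact: bounded_measurable_integrable.
Qed.

Lemma state_comp J (T : X -> X) : measurable_fun setT T -> state J ->
  state (fun f => J (fun x => f (T x))).
Proof.
move=> mT hJ; have mc := bounded_measurable_comp _ _ mT; split.
- exact: state1.
- by move=> f g /mc mf /mc mg; rewrite (stateD _ hJ).
- by move=> c f /mc mf; rewrite (stateZ _ hJ).
- by move=> f g /mc mf /mc mg fg; apply: (state_le _ hJ).
Qed.

Lemma state_birkhoff J (T : X -> X) n : (0 < n)%N -> measurable_fun setT T ->
  state J -> state (fun f => J (birkhoff T f n)).
Proof.
move=> n0 mT hJ; have mb f := bounded_measurable_birkhoff T f n mT.
have nR : n%:R != 0 :> R by rewrite pnatr_eq0 -lt0n.
split.
- rewrite (_ : birkhoff _ _ _ = fun=> 1) ?(state1 _ hJ)//.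
  by apply/funext => x; rewrite /birkhoff sumr_const card_ord mulVf.
- move=> f g /mb mf /mb mg; rewrite -(stateD _ hJ)//; congr J.
  by apply/funext => x; rewrite /birkhoff big_split mulrDr.
- move=> c f /mb mf; rewrite -(stateZ _ hJ)//; congr J.
  by apply/funext => x; rewrite /birkhoff -mulr_sumr mulrCA.
- move=> f g /mb mf /mb mg fg; apply: (state_le _ hJ) => // x.
  by rewrite ler_wpM2l ?invr_ge0// ler_sum.
Qed.

Lemma state_density (mu : probability X R) (D : X -> R) :
  bounded_measurable D -> (forall x, 0 <= D x) -> 0 < \int[mu]_x D x ->
  state (fun f => (\int[mu]_x (f x * D x)) / (\int[mu]_x D x)).
Proof.
move=> mD D0 I0; have hm := state_prob mu.
have mfD f : bounded_measurable f -> bounded_measurable (fun x => f x * D x).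
  by move=> mf; exact: bounded_measurableM.
split.
- by under eq_fun do rewrite mul1r; rewrite divff ?gt_eqF.
- move=> f g /mfD mf /mfD mg; rewrite -mulrDl -(stateD _ hm)//.
  by under [in RHS]eq_fun do rewrite -mulrDl.
- move=> c f /mfD mf; rewrite mulrA -(stateZ _ hm)//.
  by under [in RHS]eq_fun do rewrite mulrA.
- move=> f g mf mg fg; apply: ler_wpM2r; first by rewrite invr_ge0 ltW.
  have /= le_mu := state_le _ hm; apply: le_mu; [exact: mfD|exact: mfD|].
  by move=> x; rewrite ler_wpM2r.
Qed.

End state.

(** * Entropy of finite labellings *)

Section labelling.
Context {d : measure_display} {X : measurableType d}.

(** A finite measurable partition, encoded by the map sending a point to its
    cell: joins, coarsenings and pull-backs become pairs and compositions. *)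
Definition measurable_label {K : finType} (alpha : X -> K) :=
  forall a, measurable (alpha @^-1` [set a]).

Lemma measurable_label_preimage {K : finType} (alpha : X -> K) (B : set K) :
  measurable_label alpha -> measurable (alpha @^-1` B).
Proof.
move=> ma; rewrite (_ : _ @^-1` _ = \bigcup_(a in B) alpha @^-1` [set a]).
  by apply: fin_bigcup_measurable => // a _; exact: ma.
apply/seteqP; split => [x Bx|x [a Ba xa]]; first by exists (alpha x).
by rewrite /preimage /= xa.
Qed.

Lemma measurable_label_map {K L : finType} (h : K -> L) (alpha : X -> K) :
  measurable_label alpha -> measurable_label (fun x => h (alpha x)).
Proof. by move=> ma b; exact: (measurable_label_preimage alpha (h @^-1` [set b])). Qed.

Lemma measurable_label_pair {K L : finType} (alpha : X -> K) (beta : X -> L) :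
  measurable_label alpha -> measurable_label beta ->
  measurable_label (fun x => (alpha x, beta x)).
Proof.
move=> ma mb [a b]; have -> : (fun x => (alpha x, beta x)) @^-1` [set (a, b)] =
    alpha @^-1` [set a] `&` beta @^-1` [set b].
  by apply/seteqP; split => x /= [-> ->].
exact: measurableI.
Qed.

Lemma measurable_label_comp {K : finType} (alpha : X -> K) (T : X -> X) :
  measurable_fun setT T -> measurable_label alpha ->
  measurable_label (fun x => alpha (T x)).
Proof.
move=> mT ma a; rewrite -[_ @^-1` _]setTI.
by apply: (mT measurableT (alpha @^-1` [set a])).
Qed.

Definition block {K : finType} (T : X -> X) (alpha : X -> K) (n : nat) (x : X) :
  {ffun 'I_n -> K} := [ffun i : 'I_n => alpha (iter i T x)].

Lemma block_preimage {K : finType} (T : X -> X) (alpha : X -> K) n w :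
  block T alpha n @^-1` [set w] =
  \bigcap_(i in [set: 'I_n]) (iter i T @^-1` (alpha @^-1` [set w i])).
Proof.
apply/seteqP; split => [x /= <- i _ /=|x /= h]; first by rewrite ffunE.
by apply/ffunP => i; rewrite ffunE; exact: h.
Qed.

Lemma measurable_label_block {K : finType} (T : X -> X) (alpha : X -> K) n :
  measurable_fun setT T -> measurable_label alpha ->
  measurable_label (block T alpha n).
Proof.
move=> mT ma w; rewrite block_preimage.
apply: fin_bigcap_measurable => // i _; rewrite -[_ @^-1` _]setTI.
by apply: measurable_iter => //; exact: ma.
Qed.

Context {R : realType}.

Lemma bounded_measurable_label {K : finType} (alpha : X -> K) (F : K -> R) :
  measurable_label alpha -> bounded_measurable (fun x => F (alpha x)).
Proof.
move=> ma; split.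
  by move=> _ B mB; rewrite setTI; exact: (measurable_label_preimage alpha (F @^-1` B)).
exists (\sum_a `|F a|) => x; rewrite (bigD1 (alpha x))//= lerDl.
by rewrite sumr_ge0.
Qed.

Lemma label_prob {K : finType} (rho : probability X R) (alpha : X -> K) a :
  measurable_label alpha ->
  \int[rho]_x (alpha x == a)%:R = fine (rho (alpha @^-1` [set a])).
Proof.
move=> ma; rewrite /Rintegral.
rewrite (_ : (fun x => _) = EFin \o \1_(alpha @^-1` [set a])).
  by rewrite integral_indic// setIT.
apply/funext => x /=; rewrite indicE; congr ((nat_of_bool _)%:R)%:E.
by apply/idP/idP => [/eqP xa|/set_mem /= ->//]; exact/mem_set.
Qed.

Section law.
Variable J : (X -> R) -> R.
Hypothesis hJ : state J.

Definition law {K : finType} (alpha : X -> K) (a : K) : R :=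
  J (fun x => (alpha x == a)%:R).

Lemma law_ge0 {K : finType} (alpha : X -> K) a : measurable_label alpha ->
  0 <= law alpha a.
Proof.
move=> ma; apply: (state_ge0 _ hJ) => [|x]; last exact: ler0n.
exact: (bounded_measurable_label _ (fun b => (b == a)%:R)).
Qed.

Lemma state_label {K : finType} (alpha : X -> K) (F : K -> R) :
  measurable_label alpha ->
  J (fun x => F (alpha x)) = \sum_a law alpha a * F a.
Proof.
move=> ma; have mI a := bounded_measurable_label alpha (fun b => (b == a)%:R) ma.
transitivity (J (fun x => \sum_a F a * (alpha x == a)%:R)).
  congr J; apply/funext => x; rewrite (bigD1 (alpha x))//= eqxx mulr1.
  by rewrite big1 ?addr0// => a /negPf; rewrite eq_sym => ->; rewrite mulr0.
rewrite (state_sum _ hJ); last by move=> a; exact/bounded_measurableZ/mI.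
by apply: eq_bigr => a _; rewrite mulrC (stateZ _ hJ).
Qed.

Lemma sum_law {K : finType} (alpha : X -> K) : measurable_label alpha ->
  \sum_a law alpha a = 1.
Proof.
move=> ma; rewrite -[RHS](state_cst _ hJ) (state_label alpha (fun=> 1))//.
by under [RHS]eq_bigr do rewrite mulr1.
Qed.

Lemma law_map {K L : finType} (h : K -> L) (alpha : X -> K) b :
  measurable_label alpha ->
  law (fun x => h (alpha x)) b = \sum_a law alpha a * (h a == b)%:R.
Proof. by move=> ma; rewrite -(state_label alpha (fun a => (h a == b)%:R)). Qed.

Lemma law_le_map {K L : finType} (h : K -> L) (alpha : X -> K) a :
  measurable_label alpha -> law alpha a <= law (fun x => h (alpha x)) (h a).
Proof.
move=> ma; rewrite law_map// (bigD1 a)//= eqxx mulr1 lerDl.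
by rewrite sumr_ge0// => b _; rewrite mulr_ge0// law_ge0.
Qed.

Definition entropy {K : finType} (alpha : X -> K) : R :=
  - \sum_a law alpha a * ln (law alpha a).

Lemma law_le1 {K : finType} (alpha : X -> K) a : measurable_label alpha ->
  law alpha a <= 1.
Proof.
move=> ma; rewrite -(sum_law alpha ma) (bigD1 a)//= lerDl.
by rewrite sumr_ge0// => b _; exact: law_ge0.
Qed.

Lemma entropy_ge0 {K : finType} (alpha : X -> K) : measurable_label alpha ->
  0 <= entropy alpha.
Proof.
move=> ma; rewrite /entropy -sumrN sumr_ge0// => a _.
by rewrite -mulrN mulr_ge0 ?law_ge0// oppr_ge0 ln_le0// law_le1.
Qed.

Lemma entropy_variational {K : finType} (alpha : X -> K) (V : K -> R) :
  measurable_label alpha ->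
  entropy alpha + J (fun x => V (alpha x)) <= ln (\sum_a expR (V a)).
Proof.
move=> ma; rewrite state_label// gibbs_variational ?sum_law// => a.
exact: law_ge0.
Qed.

Lemma entropy_le_card {K : finType} (alpha : X -> K) : measurable_label alpha ->
  entropy alpha <= ln #|K|%:R.
Proof.
move=> ma; have := entropy_variational alpha (fun=> 0) ma.
by rewrite (state_cst _ hJ) addr0 expR0 sumr_const.
Qed.

(** Coarsening loses entropy because each class weighs at least as much as each
    of its members. *)
Lemma entropy_map {K L : finType} (h : K -> L) (alpha : X -> K) :
  measurable_label alpha -> entropy (fun x => h (alpha x)) <= entropy alpha.
Proof.
move=> ma; have mh := measurable_label_map h alpha ma.
pose F b := ln (law (fun x => h (alpha x)) b).
rewrite /entropy -(state_label (fun x => h (alpha x)) F)//.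
rewrite (state_label alpha (fun a => F (h a)))// lerN2 ler_sum// => a _.
have [->|] := eqVneq (law alpha a) 0; first by rewrite !mul0r.
rewrite eq_le law_ge0// andbT -ltNge => p0.
rewrite ler_wpM2l ?law_ge0// ler_ln ?posrE// ?law_le_map//.
exact: lt_le_trans p0 (law_le_map _ _ _ ma).
Qed.

(** Subadditivity is cross entropy against the product of the marginals. *)
Lemma entropy_pair {K L : finType} (alpha : X -> K) (beta : X -> L) :
  measurable_label alpha -> measurable_label beta ->
  entropy (fun x => (alpha x, beta x)) <= entropy alpha + entropy beta.
Proof.
move=> ma mb; have mab := measurable_label_pair alpha beta ma mb.
set gamma := (fun x => _) in mab *.
pose q (c : K * L) := law alpha c.1 * law beta c.2.
have pa c : law gamma c <= law alpha c.1 by exact: (law_le_map fst gamma).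
have pb c : law gamma c <= law beta c.2 by exact: (law_le_map snd gamma).
apply: (@le_trans _ _ (- \sum_c law gamma c * ln (q c))).
  apply: entropy_le_cross.
  - by move=> c; exact: law_ge0.
  - by move=> c; rewrite mulr_ge0 ?law_ge0.
  - rewrite sum_law// -(pair_big xpredT xpredT (fun a b => q (a, b)))/=.
    rewrite /q/=; under eq_bigr do rewrite -mulr_sumr sum_law// mulr1.
    by rewrite sum_law.
  - move=> c c0; rewrite mulr_gt0//; first exact: lt_le_trans c0 (pa c).
    exact: lt_le_trans c0 (pb c).
rewrite le_eqVlt; apply/orP; left; apply/eqP.
rewrite /entropy -opprD; congr (- _).
rewrite -(state_label alpha (fun a => ln (law alpha a)))//.
rewrite -(state_label beta (fun b => ln (law beta b)))//.
rewrite (state_label gamma (fun c => ln (law alpha c.1)))//.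
rewrite (state_label gamma (fun c => ln (law beta c.2)))// -big_split/=.
apply: eq_bigr => c _; rewrite -mulrDr.
have [->|] := eqVneq (law gamma c) 0; first by rewrite !mul0r.
rewrite eq_le law_ge0// andbT -ltNge => c0.
by rewrite lnM// posrE; [exact: lt_le_trans c0 (pa c)|exact: lt_le_trans c0 (pb c)].
Qed.

End law.
End labelling.

(** * Entropy along orbits *)

Section block_entropy.
Context {d : measure_display} {X : measurableType d} {R : realType}.
Variables (T : X -> X) (K : finType) (alpha : X -> K).
Hypothesis mT : measurable_fun setT T.
Hypothesis ma : measurable_label alpha.
Implicit Type J : (X -> R) -> R.

Lemma block_cat n l x : block T alpha (n + l) x =
  [ffun i : 'I_(n + l) => match fintype.split i with
             | inl j => block T alpha n x j
             | inr k => block T alpha l (iter n T x) k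
             end].
Proof.
apply/ffunP => i; rewrite !ffunE; case: split_ordP => j ->; rewrite ffunE//=.
by rewrite addnC iterD.
Qed.

Lemma entropy_block_cat J n l : state J ->
  entropy J (block T alpha (n + l)) <= entropy J (block T alpha n) +
    entropy (fun f => J (fun x => f (iter n T x))) (block T alpha l).
Proof.
move=> hJ; have mb k := measurable_label_block T alpha k mT ma.
have mbn := measurable_label_comp _ _ (measurable_iter T n mT) (mb l).
rewrite (funext (block_cat n l)).
pose h (c : {ffun 'I_n -> K} * {ffun 'I_l -> K}) : {ffun 'I_(n + l) -> K} :=
  [ffun i : 'I_(n + l) => match fintype.split i with inl j => c.1 j | inr k => c.2 k end].
apply: le_trans (entropy_pair J hJ _ _ (mb n) mbn).
exact: (entropy_map J hJ h _ (measurable_label_pair _ _ (mb n) mbn)).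
Qed.

Lemma entropy_block_le J n : state J ->
  entropy J (block T alpha n) <= n%:R * ln #|K|%:R.
Proof.
move=> hJ; apply: le_trans (entropy_le_card J hJ _ _) _.
  exact: measurable_label_block.
rewrite card_ffun card_ord natrX mulr_natl.
have [K0|K0] := posnP #|K|; last by rewrite lnXn ?ltr0n.
by rewrite K0 expr0n (@ln0 _ 0)// mul0rn; case: n => [|n]; rewrite ?ln1 ?ln0.
Qed.

Section average.
Variable J : (X -> R) -> R.
Hypothesis hJ : state J.
Let hJT n : state (fun f => J (fun x => f (iter n T x))).
Proof. by apply: state_comp => //; exact: measurable_iter. Qed.

Let a q i := entropy (fun f => J (fun x => f (iter i T x))) (block T alpha q).

Let entropy_blocks q r k :
  entropy (fun f => J (fun x => f (iter r T x))) (block T alpha (k * q)) <=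
  \sum_(j < k) a q (j * q + r).
Proof.
elim: k => [|k IH].
  by rewrite big_ord0 mul0n (le_trans (entropy_block_le _ _ (hJT _)))// mul0r.
rewrite mulSn addnC big_ord_recr/=.
apply: le_trans (entropy_block_cat _ _ _ (hJT r)) _.
rewrite lerD// /a.
suff -> : (fun f => J (fun x => f (iter (k * q + r) T x))) =
  (fun f : X -> R => J (fun x => f (iter (k * q) T (iter r T x)))) by [].
by apply/funext => f; congr J; apply/funext => x; rewrite iterD.
Qed.

Let sum_offsets (b : nat -> R) q k :
  \sum_(r < q) \sum_(j < k) b (j * q + r)%N = \sum_(i < k * q) b i.
Proof.
rewrite exchange_big/=; elim: k => [|k IH]; first by rewrite big_ord0 mul0n big_ord0.
by rewrite big_ord_recr/= IH mulSn addnC big_split_ord.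
Qed.

(** For each offset $r<q$ cut $[r,n)$ into consecutive blocks of length $q$ and
    use subadditivity; the two incomplete ends together have at most $2q$
    letters. Summed over the offsets, every starting point in $[0,n)$ is used at
    most once. *)
Lemma entropy_block_sum q n : (0 < q)%N -> (q <= n)%N ->
  q%:R * entropy J (block T alpha n) <=
  \sum_(i < n) a q i + 2 * q%:R ^+ 2 * ln #|K|%:R.
Proof.
move=> q0 qn; set L := ln _.
pose k := (n %/ q).-1.
have kq : (k.+1 * q <= n)%N.
  by rewrite /k prednK ?divn_gt0// leq_divM.
have nk : (n <= k * q + 2 * q)%N.
  rewrite -mulnDl /k -subn1 addnC addnBA ?divn_gt0// addnC -addnBA//.
  by rewrite addn1 ltnW// ltn_ceil.
have one r : (r < q)%N ->
    entropy J (block T alpha n) <= \sum_(j < k) a q (j * q + r) + 2 * q%:R * L.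
  move=> rq.
  have rn : (r + k * q <= n)%N.
    by rewrite (leq_trans _ kq)// mulSn leq_add2r ltnW.
  pose s := (n - (r + k * q))%N.
  have -> : n = (r + (k * q + s))%N by rewrite addnA subnKC.
  have h1 := entropy_block_cat J r (k * q + s) hJ.
  have h2 := entropy_block_cat _ (k * q) s (hJT r).
  have h3 := entropy_blocks q r k.
  have h4 := entropy_block_le J r hJ.
  have h5 := entropy_block_le _ s (state_comp _ _ (measurable_iter T (k * q) mT) (hJT r)).
  have h6 : (r%:R + s%:R) * L <= 2 * q%:R * L.
    rewrite -natrD -natrM; apply: ler_wpM2r.
      rewrite /L; have [->|K0] := posnP #|K|; first by rewrite ln0.
      by rewrite ln_ge0// ler1n.
    by rewrite ler_nat /s; lia.
  have : (r%:R + s%:R) * L = r%:R * L + s%:R * L by rewrite mulrDl.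
  move: h1 h2 h3 h4 h5 h6 => /=; rewrite -/L; lra.
rewrite mulr_natl -[X in _ *+ X]card_ord -sumr_const.
have : \sum_(r < q) entropy J (block T alpha n) <=
    \sum_(r < q) (\sum_(j < k) a q (j * q + r) + 2 * q%:R * L).
  by apply: ler_sum => r _; exact: one.
move=> /le_trans; apply; rewrite big_split/= sum_offsets sumr_const card_ord.
rewrite lerD//; last by rewrite -mulr_natl; lra.
have kqn : (k * q <= n)%N by rewrite (leq_trans _ kq)// mulSn leq_addl.
rewrite -(subnKC kqn) big_split_ord/=.
rewrite lerDl sumr_ge0// => i _; apply: entropy_ge0; first exact: hJT.
exact: measurable_label_block.
Qed.

(** Concavity of the entropy: each shifted law is compared, through cross
    entropy, with the law of the orbit average. *)
Lemma entropy_average (L : finType) (beta : X -> L) n : measurable_label beta ->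
  (0 < n)%N ->
  \sum_(i < n) entropy (fun f => J (fun x => f (iter i T x))) beta <=
  n%:R * entropy (fun f => J (birkhoff T f n)) beta.
Proof.
move=> mb n0; set A := (fun f => J _).
have nR : 0 < n%:R :> R by rewrite ltr0n.
pose p (i : nat) u := law (fun f => J (fun x => f (iter i T x))) beta u.
have pA u : n%:R * law A beta u = \sum_(i < n) p i u.
  have mI := bounded_measurable_label beta (fun b => (b == u)%:R : R) mb.
  rewrite /law /A /birkhoff (stateZ _ hJ); last first.
    apply: bounded_measurable_sum => i.
    exact: (bounded_measurable_iter T _ i mT mI).
  rewrite mulVKf ?gt_eqF// (state_sum _ hJ)// => i.
  exact: (bounded_measurable_iter T _ i mT mI).
have p0 i u : 0 <= p i u by apply: law_ge0 => //; exact: hJT.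
have hA : state A by exact: state_birkhoff.
rewrite mulrN mulr_sumr.
under [X in _ <= - X]eq_bigr do rewrite mulrA pA mulr_suml.
rewrite exchange_big/= -sumrN ler_sum// => i _.
apply: entropy_le_cross; [exact: p0|by move=> u; exact: law_ge0| |].
  by rewrite !sum_law//; exact: hJT.
move=> u pu; rewrite -(pmulr_rgt0 _ nR) pA (bigD1 i)//=.
by rewrite ltr_wpDr// sumr_ge0.
Qed.

(** Misiurewicz's inequality. The state need not be invariant, whereas its orbit
    average is nearly so; with $q$ fixed and $n\to\infty$ the error term is
    negligible after division by $n$. *)
Lemma entropy_block_average q n : (0 < q)%N -> (q <= n)%N ->
  q%:R * entropy J (block T alpha n) <=
  n%:R * entropy (fun f => J (birkhoff T f n)) (block T alpha q) +
  2 * q%:R ^+ 2 * ln #|K|%:R.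
Proof.
move=> q0 qn; apply: le_trans (entropy_block_sum q n q0 qn) _.
rewrite lerD2r; apply: entropy_average; last exact: leq_trans qn.
exact: measurable_label_block.
Qed.

End average.
End block_entropy.

(** * Entropy of invariant probabilities *)

Section invariant.
Context {d : measure_display} {X : measurableType d} {R : realType}.
Variable T : X -> X.
Hypothesis mT : measurable_fun setT T.
Implicit Type rho : probability X R.

Lemma invariant_integral rho f : invariant_prob T rho -> bounded_measurable f ->
  \int[rho]_x f (T x) = \int[rho]_x f x.
Proof.
move=> inv mf; rewrite /Rintegral; congr fine.
have [m_f _] := mf.
rewrite -(@integral_pushforward _ _ _ _ _ T mT rho setT (EFin \o f))//.
- apply: eq_measure_integral => A mA _; exact: inv.
- exact/measurable_EFinP.
- apply: (bounded_measurable_integrable rho (fun x => f (T x))).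
  exact: bounded_measurable_comp.
Qed.

Lemma invariant_integral_iter rho f n : invariant_prob T rho ->
  bounded_measurable f -> \int[rho]_x f (iter n T x) = \int[rho]_x f x.
Proof.
move=> inv mf; elim: n => // n IH; rewrite -{}IH.
under eq_Rintegral do rewrite iterSr.
by rewrite (invariant_integral _ (fun x => f (iter n T x)))//;
   exact: bounded_measurable_iter.
Qed.

Lemma invariant_integral_sum rho f n : invariant_prob T rho ->
  bounded_measurable f ->
  \int[rho]_x (\sum_(i < n) f (iter i T x)) = n%:R * \int[rho]_x f x.
Proof.
move=> inv mf; have /= sumE := state_sum _ (state_prob rho).
rewrite sumE; last by move=> i; exact: bounded_measurable_iter.
under eq_bigr do rewrite invariant_integral_iter//.
by rewrite sumr_const card_ord mulr_natl.
Qed.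

Lemma partition_label k (A : 'I_k -> set X) : measurable_partition A ->
  exists2 alpha : X -> 'I_k, measurable_label alpha &
    forall i, A i = alpha @^-1` [set i].
Proof.
move=> [mA tA cA].
have /choice[alpha Aalpha] : forall x, exists i, A i x.
  by move=> x; have : [set: X] x by []; rewrite -cA => -[i _ Ai]; exists i.
have E i : A i = alpha @^-1` [set i].
  apply/seteqP; split => [x Ax|x /= <-]; last exact: Aalpha.
  by apply: (tA _ _ I I); exists x; split.
by exists alpha => // i; rewrite -E.
Qed.

Lemma join_entropyE rho k (A : 'I_k -> set X) (alpha : X -> 'I_k) n :
  measurable_label alpha -> (forall i, A i = alpha @^-1` [set i]) ->
  join_entropy T rho A n =
  entropy (fun f => \int[rho]_x f x) (block T alpha n).
Proof.
move=> ma AE; congr (- _); apply: eq_bigr => w _.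
suff -> : fine (rho (join_atom T A w)) =
  law (fun f => \int[rho]_x f x) (block T alpha n) w by [].
rewrite /law label_prob; last exact: measurable_label_block.
rewrite block_preimage; congr (fine (rho _)).
by apply: eq_bigcapr => i _; rewrite AE.
Qed.

Section partition_entropy.
Variables (k : nat) (A : 'I_k -> set X) (rho : probability X R).
Hypotheses (pA : measurable_partition A) (inv : invariant_prob T rho).

Let join_ge0 n : 0 <= join_entropy T rho A n.
Proof.
have [alpha ma AE] := partition_label _ _ pA.
rewrite (join_entropyE _ _ _ alpha)//.
apply: (entropy_ge0 _ (state_prob rho)); exact: measurable_label_block.
Qed.

Let join_subadditive n l :
  join_entropy T rho A (n + l) <= join_entropy T rho A n + join_entropy T rho A l.
Proof.
have [alpha ma AE] := partition_label _ _ pA.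
rewrite !(join_entropyE _ _ _ alpha)//.
apply: le_trans (entropy_block_cat T _ alpha mT ma _ n l (state_prob rho)) _.
rewrite lerD2l le_eqVlt; apply/orP; left; apply/eqP; congr (- _).
apply: eq_bigr => w _; set u := law _ _ _; set v := law _ _ _.
suff -> : u = v by [].
apply: (invariant_integral_iter rho
    (fun x => (block T alpha l x == w)%:R)) => //.
apply: (bounded_measurable_label _ (fun b => (b == w)%:R)).
exact: measurable_label_block.
Qed.

Lemma partition_entropy_cvg :
  n%:R^-1 * join_entropy T rho A n @[n --> \oo] --> partition_entropy T rho A.
Proof.
have cv := fekete_cvg (join_entropy T rho A) join_ge0 join_subadditive.
by rewrite /partition_entropy; have /cvg_lim -> := cv.
Qed.

Lemma partition_entropy_le n : (0 < n)%N ->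
  partition_entropy T rho A <= n%:R^-1 * join_entropy T rho A n.
Proof.
have cv := fekete_cvg (join_entropy T rho A) join_ge0 join_subadditive.
move=> n0; rewrite /partition_entropy; have /cvg_lim -> // := cv.
by apply: fekete_le => //; exact: join_ge0.
Qed.

End partition_entropy.

Lemma partition_entropy_le_ks k (A : 'I_k -> set X) rho :
  measurable_partition A -> ((partition_entropy T rho A)%:E <= ks_entropy T rho)%E.
Proof. by move=> pA; apply: ereal_sup_ubound; exists k, A. Qed.

End invariant.

Section affine.
Context {d : measure_display} {X : measurableType d} {R : realType}.

(** Entropy is affine up to a constant: $tp_1\le p$ gives
    $-\ln p\le-\ln p_1-\ln t$. The constant disappears from the entropy per unit
    time. *)
Lemma entropy_mix (K : finType) (p p1 p2 : K -> R) (t : R) : 0 < t < 1 ->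
  (forall a, 0 <= p1 a) -> (forall a, 0 <= p2 a) ->
  \sum_a p1 a = 1 -> \sum_a p2 a = 1 ->
  (forall a, p a = t * p1 a + (1 - t) * p2 a) ->
  - (\sum_a p a * ln (p a)) <= t * (- \sum_a p1 a * ln (p1 a)) +
    (1 - t) * (- \sum_a p2 a * ln (p2 a)) - (t * ln t + (1 - t) * ln (1 - t)).
Proof.
move=> /andP[t0 t1] p10 p20 sp1 sp2 pE; have t'0 : 0 < 1 - t by rewrite subr_gt0.
have key (q : K -> R) (s : R) : 0 < s -> (forall a, 0 <= q a) ->
    \sum_a q a = 1 -> (forall a, s * q a <= p a) ->
    - (\sum_a s * q a * ln (p a)) <= s * (- \sum_a q a * ln (q a)) - s * ln s.
  move=> s0 q0 sq qp; rewrite mulrN -opprD lerN2 -[ln s]mul1r -[in leLHS]sq.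
  rewrite mulr_suml -mulrDr -big_split/= mulr_sumr ler_sum// => a _.
  have [->|qa0] := eqVneq (q a) 0; first by rewrite !(mul0r, mulr0, addr0).
  have qa : 0 < q a by rewrite lt_def qa0 q0.
  rewrite -mulrA ler_pM2l// -mulrDr ler_pM2l// addrC -lnM ?posrE//.
  rewrite ler_ln ?posrE ?mulr_gt0//.
  by apply: lt_le_trans (qp a); rewrite mulr_gt0.
have h1 := key p1 t t0 p10 sp1.
have h2 := key p2 (1 - t) t'0 p20 sp2.
have -> : \sum_a p a * ln (p a) =
    \sum_a t * p1 a * ln (p a) + \sum_a (1 - t) * p2 a * ln (p a).
  by rewrite -big_split/=; apply: eq_bigr => a _; rewrite -mulrDl -pE.
have q1 a : t * p1 a <= p a by rewrite pE lerDl mulr_ge0// ltW.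
have q2 a : (1 - t) * p2 a <= p a by rewrite pE lerDr mulr_ge0// ltW.
have := h1 q1; have := h2 q2; lra.
Qed.

End affine.

(** * Topology of the sequence space *)

Section sequence_space.
Context {m : nat}.
Implicit Types x y : Omega m.

Definition agree (N : nat) x y := forall n, (n < N)%N -> x n = y n.

(** The clopen sets. Quantifying over agreeing points lets sets that depend on
    different numbers of letters be combined without reindexing words. *)
Definition cylindrical (A : set (Omega m)) :=
  exists N, forall x y, agree N x y -> A x -> A y.

Lemma agree_sym N x y : agree N x y -> agree N y x.
Proof. by move=> xy n nN; rewrite xy. Qed.

Lemma agree_trans N x y z : agree N x y -> agree N y z -> agree N x z.
Proof. by move=> xy yz n nN; rewrite xy// yz. Qed.

Lemma agree_le M N x y : (M <= N)%N -> agree N x y -> agree M x y.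
Proof. by move=> MN xy n nM; exact/xy/(leq_trans nM). Qed.

Lemma iter_shift k x n : iter k (@left_shift m) x n = x (k + n)%N.
Proof.
elim: k n => // k IH n; rewrite iterS {1}/left_shift IH.
by rewrite addnS.
Qed.

Lemma agree_shift k N x y : agree (k + N) x y ->
  agree N (iter k (@left_shift m) x) (iter k (@left_shift m) y).
Proof. by move=> xy n nN; rewrite !iter_shift xy// ltn_add2l. Qed.

Lemma cylindricalT : cylindrical setT.
Proof. by exists 0%N. Qed.

Lemma cylindrical0 : cylindrical set0.
Proof. by exists 0%N. Qed.

Lemma cylindricalC A : cylindrical A -> cylindrical (~` A).
Proof. by move=> [N AN]; exists N => x y xy Ax /(AN _ _ (agree_sym _ _ _ xy)). Qed.

Lemma cylindricalI A B : cylindrical A -> cylindrical B -> cylindrical (A `&` B).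
Proof.
move=> [M AM] [N BN]; exists (maxn M N) => x y xy [Ax Bx]; split.
  by apply: AM Ax; apply: agree_le xy; exact: leq_maxl.
by apply: BN Bx; apply: agree_le xy; exact: leq_maxr.
Qed.

Lemma cylindricalU A B : cylindrical A -> cylindrical B -> cylindrical (A `|` B).
Proof.
move=> cA cB; rewrite -[_ `|` _]setCK setCU.
by apply/cylindricalC/cylindricalI; exact: cylindricalC.
Qed.

Lemma nbhs_agree x (A : set (Omega m)) :
  nbhs x A <-> exists N, forall y, agree N x y -> A y.
Proof.
split=> [xA|[N NA]].
  pose F : set_system (Omega m) := filter_from [set: nat] (fun N => agree N x).
  have FF : Filter F.
    apply: filter_from_filter; first by exists 0%N.
    move=> i j _ _; exists (maxn i j) => // y xy; split;
      apply: agree_le xy; [exact: leq_maxl|exact: leq_maxr].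
  suff : F --> x by move=> /(_ _ xA)[N _ NA]; exists N.
  apply/cvg_sup => n B [_ [[U _ <-] Uxn UB]].
  by exists n.+1 => // y xy; apply: UB => /=; rewrite -xy.
have nx n : nbhs x [set y : Omega m | x n = y n].
  have xn : nbhs (x n) [set x n] by exact: discrete_set1.
  have := @proj_continuous nat (fun=> discrete_topology 'I_m.+1) n x _ xn.
  by apply: (@filterS _ (nbhs x)) => y /= yn; exact: esym yn.
apply: (@filterS _ (nbhs x) _ (agree N x)); first exact: NA.
elim: N {NA} => [|N IH]; first by apply: (@filterS _ (nbhs x)) filterT.
apply: (@filterS _ (nbhs x)) (filterI IH (nx N)) => y [H yN] n /=.
by rewrite ltnS leq_eqVlt => /predU1P[->//|]; exact: H.
Qed.

Lemma open_agree (A : set (Omega m)) :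
  open A <-> forall x, A x -> exists N, forall y, agree N x y -> A y.
Proof.
rewrite openE; split => [AA x /AA /nbhs_agree//|h x Ax].
exact/nbhs_agree/h.
Qed.

Lemma open_cylindrical A : cylindrical A -> open A.
Proof.
by move=> [N AN]; apply/open_agree => x Ax; exists N => y xy; exact: AN Ax.
Qed.

Lemma cylindrical_measurable A : cylindrical A -> measurable A.
Proof. by move=> /open_cylindrical oA; exact: sub_sigma_algebra. Qed.

Lemma open_bigcup_cylindrical (A : set (Omega m)) : open A ->
  exists2 F : nat -> set (Omega m), (forall N, cylindrical (F N)) &
    A = \bigcup_N F N.
Proof.
move=> /open_agree oA.
exists (fun N => [set x | forall y, agree N x y -> A y]) => [N|].
  exists N => x y xy /= h z yz; apply: h; exact: agree_trans yz.
apply/seteqP; split => [x /oA[N AN]|x [N _ /= h]]; first by exists N.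
exact: h.
Qed.

Lemma sigma_cylindrical :
  @measurable _ (Omega m) = <<s cylindrical >>.
Proof.
apply/seteqP; split; apply: smallest_sub.
- exact: smallest_sigma_algebra.
- move=> A /open_bigcup_cylindrical[F cF ->].
  apply: (@bigcupT_measurable _ (g_sigma_algebraType cylindrical)) => N.
  exact: sub_sigma_algebra.
- exact: sigma_algebra_measurable.
- by move=> A /cylindrical_measurable.
Qed.

Lemma measurable_left_shift :
  measurable_fun setT (@left_shift m).
Proof.
apply: (measurability cylindrical sigma_cylindrical) => _ [A [N AN] <-].
rewrite setTI; apply: cylindrical_measurable; exists N.+1 => x y xy.
by apply: AN => n nN; exact: xy.
Qed.

Lemma compact_sequence_space : compact [set: Omega m].
Proof.
have := @tychonoff nat (fun=> discrete_topology 'I_m.+1) (fun=> setT).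
move=> /(_ (fun _ => _)) h.
have -> : [set: Omega m] = [set f | forall i : nat, [set: discrete_topology 'I_m.+1] (f i)].
  by apply/seteqP; split.
by apply: h => i; apply: finite_compact; exact: finite_finset.
Qed.

(** Compactness of the sequence space, in the form of a passage from local to
    uniform: a property that holds near every point from some level on holds
    everywhere from a common level on. *)
Lemma agree_compactness (P : nat -> Omega m -> Prop) :
  (forall x, exists N, forall M y, (N <= M)%N -> agree N x y -> P M y) ->
  exists N, forall M x, (N <= M)%N -> P M x.
Proof.
move=> h; have := compact_sequence_space.
move=> /compact_near_coveringP /(_ nat \oo P _) [x _|N _ NP].
  have [N hN] := h x.
  exists ([set y | agree N x y], [set M | (N <= M)%N]) => /=.
    split; last by exists N.
    by apply/nbhs_agree; exists N.
  by move=> [y M] [/= xy NM]; exact: hN.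
by exists N => M x NM; exact: NP.
Qed.

Section real_valued.
Context {R : realType}.
Implicit Type g : Omega m -> R.

Lemma continuous_agree g : continuous g <-> forall x e, 0 < e ->
  exists N, forall y, agree N x y -> `|g x - g y| <= e.
Proof.
split=> [cg x e e0|h x].
  have /cvgrPdist_le/(_ e e0)/nbhs_agree[N hN] := cg x.
  by exists N.
move=> A /nbhs_ballP[e /= e0 eA].
have [N hN] := h x (e / 2) (divr_gt0 e0 (ltr0n _ 2)).
apply/nbhs_agree; exists N => y xy; apply: eA => /=.
rewrite /ball/= (le_lt_trans (hN y xy))//.
by rewrite ltr_pdivrMr// ltr_pMr// ltr1n.
Qed.

Lemma uniformly_continuous g e : continuous g -> 0 < e ->
  exists N, forall x y, agree N x y -> `|g x - g y| <= e.
Proof.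
move=> /continuous_agree cg e0.
have [|N hN] := agree_compactness
    (fun M x => forall y, agree M x y -> `|g x - g y| <= e).
  move=> x; have [N hN] := cg x (e / 2) (divr_gt0 e0 (ltr0n _ 2)).
  exists N => M y NM xy z yz.
  have h1 := hN _ xy; have h2 := hN z (agree_trans _ _ _ _ xy (agree_le _ _ _ _ NM yz)).
  rewrite -(subrKA (g x)) (le_trans (ler_normD _ _))// distrC.
  by rewrite (le_trans (lerD h1 h2))// -splitr.
by exists N => x y; exact: hN.
Qed.

Lemma hoelder_continuousW g : hoelder_continuous g -> continuous g.
Proof.
move=> [a [C [a0 C0 gC]]]; apply/continuous_agree => x e e0.
pose d0 : R := (e / (C + 1)) `^ a^-1.
have C1 : 0 < C + 1 by rewrite ltr_wpDl.
have eC : 0 < e / (C + 1) by rewrite divr_gt0.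
have d00 : 0 < d0 by rewrite powR_gt0.
have [N hN] : exists N, forall y, agree N x y -> seq_dist R x y < d0.
  by apply/nbhs_agree/(nbhs_seq_dist R); exists d0.
exists N => y /hN xy; apply: (le_trans (gC x y)).
have d_ge0 : 0 <= seq_dist R x y.
  by rewrite /seq_dist; case: pselect => //= xy'; rewrite invr_ge0 exprn_ge0.
have : seq_dist R x y `^ a <= e / (C + 1).
  rewrite -[leRHS]powRr1 ?(ltW eC)// -[X in _ <= _ `^ X](mulVf (lt0r_neq0 a0)) powRrM.
  by apply: ge0_ler_powR; rewrite ?nnegrE// ltW.
move=> h; apply: (@le_trans _ _ (C * (e / (C + 1)))); first exact: ler_wpM2l.
rewrite mulrCA -[leRHS]mulr1; apply: ler_wpM2l; first exact: ltW.
by rewrite ler_pdivrMr// mul1r lerDl.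
Qed.

End real_valued.
End sequence_space.

(** * Words, and measures from states *)

Section words.
Context {m : nat}.
Implicit Types x y : Omega m.

Definition letter x : 'I_m.+1 := x 0%N.

Definition word n := block (@left_shift m) letter n.

Lemma word_ith n x i : word n x i = x i.
Proof. by rewrite ffunE /letter iter_shift addn0. Qed.

Lemma word_agree n x y : word n x = word n y <-> agree n x y.
Proof.
split=> [xy k kn|xy]; last by apply/ffunP => i; rewrite !word_ith xy.
by have /ffunP/(_ (Ordinal kn)) := xy; rewrite !word_ith.
Qed.

Lemma measurable_letter : measurable_label letter.
Proof.
by move=> a; apply: cylindrical_measurable; exists 1%N => x y xy <-;
   rewrite /letter/= xy.
Qed.

Lemma measurable_word n : measurable_label (word n).
Proof.
apply: measurable_label_block; last exact: measurable_letter.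
exact: measurable_left_shift.
Qed.

(** A chosen point in the cylinder of a word, obtained by padding the word
    with the first letter of the alphabet. *)
Definition extend n (w : {ffun 'I_n -> 'I_m.+1}) : Omega m :=
  fun k => if insub k is Some i then w i else ord0.

Lemma extendE n (w : {ffun 'I_n -> 'I_m.+1}) (i : 'I_n) : extend n w i = w i.
Proof. by rewrite /extend valK. Qed.

Lemma extendK n : cancel (extend n) (word n).
Proof. by move=> w; apply/ffunP => i; rewrite word_ith extendE. Qed.

Lemma agree_extend n x : agree n x (extend n (word n x)).
Proof. by apply/word_agree; rewrite extendK. Qed.

Context {R : realType}.

Lemma continuous_bounded_measurable (g : Omega m -> R) : continuous g ->
  bounded_measurable g.
Proof.
move=> cg; split.
  apply: (measurability _ (RGenOpens.measurableE R)).
  move=> _ [_ [a [b ->] <-]]; rewrite setTI; apply: sub_sigma_algebra.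
  by move/continuousP : cg; apply; exact: interval_open.
have [N hN] := uniformly_continuous g 1 cg ltr01.
exists (1 + \sum_w `|g (extend N w)|) => x.
rewrite -(subrK (g (extend N (word N x))) (g x)).
rewrite (le_trans (ler_normD _ _))// lerD//; first exact/hN/agree_extend.
by rewrite (bigD1 (word N x))//= lerDl sumr_ge0.
Qed.

(** By uniform continuity [g] is within any [e] of a function of finitely many
    letters, on which the two states agree. *)
Lemma state_eq_continuous (J1 J2 : (Omega m -> R) -> R) (g : Omega m -> R) :
  state J1 -> state J2 ->
  (forall N w, law J1 (word N) w = law J2 (word N) w) ->
  continuous g -> J1 g = J2 g.
Proof.
move=> h1 h2 J12 cg; have mg := continuous_bounded_measurable g cg.
apply/eqP; rewrite -subr_eq0 -normr_le0; apply/ler_addgt0Pl => e e0.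
have e20 : 0 < e / 2 by rewrite divr_gt0.
have [N hN] := uniformly_continuous g _ cg e20.
pose F w := g (extend N w).
have mF : bounded_measurable (fun x => F (word N x)).
  exact: (bounded_measurable_label _ F (measurable_word N)).
have FE : J1 (fun x => F (word N x)) = J2 (fun x => F (word N x)).
  have mw := measurable_word N.
  rewrite (state_label J1 h1 _ F mw) (state_label J2 h2 _ F mw).
  by apply: eq_bigr => w _; rewrite J12.
have close x : `|g x - F (word N x)| <= e / 2 by exact/hN/agree_extend.
have d1 := state_dist _ h1 _ _ _ mg mF close.
have d2 := state_dist _ h2 _ _ _ mg mF close.
rewrite addr0 -(subrKA (J1 (fun x => F (word N x)))).
rewrite (le_trans (ler_normD _ _))// [e]splitr lerD// distrC FE distrC.
by rewrite distrC.
Qed.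

Lemma bounded_measurable_indic (A : set (Omega m)) : measurable A ->
  bounded_measurable (\1_A : Omega m -> R).
Proof.
move=> mA; split; first exact: measurable_indic.
by exists 1 => x; rewrite indicE; case: (_ \in _); rewrite ?normr0 ?normr1.
Qed.

Lemma law_word_indic (J : (Omega m -> R) -> R) N w :
  law J (word N) w = J (\1_(word N @^-1` [set w])).
Proof.
congr J; apply/funext => x; rewrite indicE; congr ((nat_of_bool _)%:R).
by apply/idP/idP => [/eqP xw|/set_mem /= ->//]; exact/mem_set.
Qed.

Lemma continuous_indic_cylindrical (A : set (Omega m)) : cylindrical A ->
  continuous (\1_A : Omega m -> R).
Proof.
move=> [N AN]; apply/continuous_agree => x e e0; exists N => y xy.
rewrite !indicE (_ : (x \in A) = (y \in A)) ?subrr ?normr0 ?ltW//.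
apply/idP/idP => /set_mem h; apply/mem_set; first exact: AN h.
by apply: AN h; exact: agree_sym.
Qed.

(** Clopen sets have continuous indicators, are stable under intersection and
    generate the Borel sets. *)
Lemma probability_unique (rho1 rho2 : probability (Omega m) R) :
  (forall g : Omega m -> R, continuous g ->
    \int[rho1]_x g x = \int[rho2]_x g x) ->
  forall A, measurable A -> rho1 A = rho2 A.
Proof.
move=> h; apply: (measure_unique cylindrical (fun=> setT)).
- exact: sigma_cylindrical.
- by move=> A B; exact: cylindricalI.
- by move=> _; exact: cylindricalT.
- by rewrite bigcup_const//; exists 0%N.
- move=> A cA; have mA := cylindrical_measurable A cA.
  have := h _ (continuous_indic_cylindrical A cA).
  rewrite /Rintegral.
  rewrite !(integral_indic _ _)// !setIT => e12.
  by rewrite -[LHS]fineK ?fin_num_measure// e12 fineK// fin_num_measure.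
- by move=> _; rewrite (le_lt_trans (probability_le1 _ _))// ltry.
Qed.

End words.

Section extension.
Context {m : nat} {R : realType}.

(** The sequence space with the algebra of clopen sets, instead of the Borel
    sets, as its measurable sets: the domain of the premeasure to be extended. *)
Definition cylinder_space (k : nat) : Type := Omega k.
HB.instance Definition _ k := Pointed.on (cylinder_space k).
HB.instance Definition _ k := isAlgebraOfSets.Build default_measure_display
  (cylinder_space k) (@cylindrical0 k) (@cylindricalU k) (@cylindricalC k).

(** The absolute value only serves to have a nonnegative value on sets that are
    not clopen. The proof [hL] is an argument so that the instances below can
    recover it from the term. *)
Definition cylinder_content (L : (Omega m -> R) -> R) (hL : state L)
  (A : set (cylinder_space m)) : \bar R := `|L (\1_A)|%:E.

Variables (L : (Omega m -> R) -> R) (hL : state L).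
Local Notation nu := (cylinder_content L hL).

Let mI (A : set (Omega m)) :
  cylindrical A -> bounded_measurable (\1_A : Omega m -> R).
Proof.
by move=> cA; apply: bounded_measurable_indic; exact: cylindrical_measurable.
Qed.

Let nuE (A : set (Omega m)) : cylindrical A -> nu A = (L (\1_A))%:E.
Proof.
move=> cA; rewrite /cylinder_content ger0_norm//.
apply: (state_ge0 _ hL) => [|x]; last by rewrite indicE.
exact: mI.
Qed.

Let nu_ge0 A : (0 <= nu A)%E.
Proof. by rewrite lee_fin. Qed.

Let nu_semi_additive : measure_function.semi_additive nu.
Proof.
have nu0 : nu set0 = 0%E.
  by rewrite /cylinder_content indic0 (state_cst _ hL) normr0.
apply/additive2P => // A B cA cB AB.
rewrite !nuE//; last exact: cylindricalU.
rewrite -EFinD -(stateD _ hL _ _ (mI _ cA) (mI _ cB)); congr (L _)%:E.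
apply/funext => x; rewrite !indicE in_setU.
have [xA|] := boolP (x \in A); have [xB|] := boolP (x \in B) => //=;
  rewrite ?addr0 ?add0r//.
by have : (A `&` B) x; [split; exact/set_mem|rewrite AB].
Qed.

HB.instance Definition _ := isContent.Build _ _ _ nu nu_ge0 nu_semi_additive.

(** By compactness a countable clopen cover of a clopen set has a finite
    subcover, which reduces countable to finite subadditivity. *)
Let nu_sigma_subadditive : measurable_subset_sigma_subadditive nu.
Proof.
move=> A F cF cA AF.
have [M hM] : exists M, forall k x, (M <= k)%N -> A x ->
    exists2 n, (n < k)%N & F n x.
  apply: (agree_compactness (fun k x => A x -> exists2 n, (n < k)%N & F n x)).
  move=> x; have [Ax|nAx] := pselect (A x).
    have [n _ Fnx] := AF _ Ax; have [N hN] := cF n.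
    exists (maxn n.+1 N) => k y nk xy _; exists n.
      by rewrite (leq_trans _ nk)// leq_maxl.
    by apply: hN Fnx; apply: agree_le xy; exact: leq_maxr.
  have [N hN] := cylindricalC _ cA; exists N => k y _ xy Ay.
  by have := hN _ _ xy nAx.
apply: le_trans (nneseries_lim_ge M (fun n _ _ => nu_ge0 (F n))).
rewrite big_mkord nuE//; under eq_bigr => i _ do rewrite (nuE _ (cF i)).
rewrite sumEFin lee_fin -(state_sum _ hL); last by move=> i; exact: (mI _ (cF i)).
apply: (state_le _ hL); first exact: mI.
  by apply: bounded_measurable_sum => i; exact: (mI _ (cF i)).
move=> x; rewrite indicE; have [/set_mem Ax|] := boolP (x \in A); last first.
  by rewrite sumr_ge0// => i _; rewrite indicE.
have [n nM Fnx] := hM M x (leqnn _) Ax.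
rewrite (bigD1 (Ordinal nM))//= indicE mem_set// lerDl sumr_ge0//.
Qed.

HB.instance Definition _ := Content_SigmaSubAdditive_isMeasure.Build _ _ _ nu
  nu_sigma_subadditive.

Definition state_measure (A : set (Omega m)) : \bar R := measure_extension nu A.


Let state_measure_ge0 A : (0 <= state_measure A)%E.
Proof. exact: measure_ge0. Qed.

Let state_measure0 : state_measure set0 = 0%E.
Proof. exact: measure0. Qed.

Let state_measure_sigma_additive : semi_sigma_additive state_measure.
Proof.
move=> F mF tF mUF; rewrite /state_measure.
have sE B : measurable B -> <<s @cylindrical m >> B.
  by rewrite sigma_cylindrical.
by apply: measure_semi_sigma_additive => // [i|]; exact: sE.
Qed.

HB.instance Definition _ := isMeasure.Build _ _ _ state_measure
  state_measure0 state_measure_ge0 state_measure_sigma_additive.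

Let state_measure_cylindrical A : cylindrical A ->
  state_measure A = (L (\1_A))%:E.
Proof.
move=> cA; rewrite /state_measure /measure_extension measurable_mu_extE//.
exact: nuE.
Qed.

Let state_measureT : state_measure setT = 1%E.
Proof.
rewrite state_measure_cylindrical; last exact: cylindricalT.
by rewrite indicT (state_cst _ hL).
Qed.

HB.instance Definition _ := Measure_isProbability.Build _ _ _ state_measure
  state_measureT.

(** The Riesz representation theorem on the sequence space: the values on clopen
    sets form a premeasure, and its extension integrates continuous functions
    correctly because these are uniform limits of functions of words. *)
Lemma state_representation : exists rho : probability (Omega m) R,
  forall g, continuous g -> \int[rho]_x g x = L g.
Proof.
exists state_measure => g cg.
apply: (state_eq_continuous _ L g (state_prob _) hL) => // N w.
have mw := measurable_word N.
rewrite [LHS](label_prob state_measure)// law_word_indic.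
have cw : cylindrical (word N @^-1` [set w]).
  by exists N => x y xy /= <-; exact/esym/word_agree.
by have /= -> := state_measure_cylindrical _ cw.
Qed.

End extension.

(** * Approximation by clopen sets *)

Section approximation.
Context {R : realType} {m : nat}.
Variable rho : probability (Omega m) R.

Definition cylindrically_approximable (A : set (Omega m)) :=
  forall e : R, 0 < e -> exists B D, [/\ cylindrical B, measurable D,
    (rho D <= e%:E)%E & forall x, ~ D x -> (A x <-> B x)].

Let approx_setU A B : cylindrically_approximable A ->
  cylindrically_approximable B -> cylindrically_approximable (A `|` B).
Proof.
move=> hA hB e e0; have e20 : 0 < e / 2 by rewrite divr_gt0.
have [A' [D [cA mD De AD]]] := hA _ e20.
have [B' [D' [cB mD' De' BD]]] := hB _ e20.
exists (A' `|` B'), (D `|` D'); split.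
- exact: cylindricalU.
- exact: measurableU.
- rewrite (le_trans (measureU2 _ mD mD'))// [e]splitr EFinD.
  exact: leeD.
- move=> x /not_orP[/AD h1 /BD h2]; split=> -[].
  + by move=> /h1; left.
  + by move=> /h2; right.
  + by move=> /h1; left.
  + by move=> /h2; right.
Qed.

Let approx_bigcup (F : nat -> set (Omega m)) : (forall i, measurable (F i)) ->
  (forall i, cylindrically_approximable (F i)) ->
  cylindrically_approximable (\bigcup_i F i).
Proof.
move=> mF hF e e0; have e20 : 0 < e / 2 by rewrite divr_gt0.
pose U n := \big[setU/set0]_(i < n) F i.
have hU n : cylindrically_approximable (U n).
  rewrite /U; elim: n => [|n IH].
    rewrite big_ord0 => e' e'0; exists set0, set0; split => //.
      exact: cylindrical0.
    by rewrite measure0 lee_fin ltW.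
  by rewrite big_ord_recr; exact: approx_setU.
pose D n := (\bigcup_i F i) `\` U n.
have mU : measurable (\bigcup_i F i) by exact: bigcupT_measurable.
have mD n : measurable (D n).
  by apply: measurableD => //; exact: bigsetU_measurable.
have D0 : \bigcap_n D n = set0.
  rewrite -subset0 => x h; have [[n _ Fnx] _] := h 0%N I.
  have [_ nU] := h n.+1 I; apply: nU.
  by rewrite /U -bigcup_mkord; exists n => /=.
have [N hN] : exists N, (rho (D N) <= (e / 2)%:E)%E.
  have := @nonincreasing_cvg_mu _ _ _ rho D.
  rewrite D0 measure0 => /(_ _ mD measurable0) cv.
  have {}cv : rho \o D @ \oo --> 0%E.
    apply: cv => [|i j ij].
      by rewrite (le_lt_trans (probability_le1 _ _))// ltry.
    apply/subsetPset; apply: setDS; rewrite /U -!bigcup_mkord.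
    by apply: bigcup_subset => k /= ki; exact: leq_trans ij.
  have /fine_cvgP[_ /cvgrPdist_le/(_ _ e20)[N _ hN]] := cv.
  exists N; rewrite -(fineK (fin_num_measure rho _ (mD N))) lee_fin.
  have := hN N (leqnn _); rewrite /= sub0r normrN.
  exact/le_trans/ler_norm.
have [B [D' [cB mD' De' BD]]] := hU N _ e20.
exists B, (D N `|` D'); split => //.
- exact: measurableU.
- rewrite (le_trans (measureU2 _ (mD N) mD'))// [e]splitr EFinD.
  exact: leeD.
- move=> x /not_orP[nD /BD <-]; split.
    by move=> Fx; apply: contrapT => nU; exact: nD.
  by rewrite /U -bigcup_mkord => -[i _ Fix]; exists i.
Qed.

(** The approximable sets form a sigma-algebra that contains the clopen sets. *)
Lemma measurable_approximable A : measurable A -> cylindrically_approximable A.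
Proof.
rewrite sigma_cylindrical => sA.
suff [] : measurable A /\ cylindrically_approximable A by [].
move: A sA; apply: smallest_sub.
- split.
  + split => // e e0; exists set0, set0; split => //; first exact: cylindrical0.
    by rewrite measure0 lee_fin ltW.
  + move=> A [mA hA]; rewrite setTD; split; first exact: measurableC.
    move=> e e0; have [B [D [cB mD De BD]]] := hA e e0.
    exists (~` B), D; split => //; first exact: cylindricalC.
    by move=> x /BD AB; split; apply: contra_not => /AB.
  + move=> F hF; have mF i : measurable (F i) by have [] := hF i.
    split; first exact: bigcupT_measurable.
    by apply: approx_bigcup => // i; have [] := hF i.
- move=> A cA; split; first exact: cylindrical_measurable.
  by move=> e e0; exists A, set0; split; rewrite ?measure0 ?lee_fin ?ltW.
Qed.

(** Each cell of the partition is approximated by a clopen set; a point outside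
    the exceptional sets lies in exactly one of these, which identifies its
    label from finitely many letters. *)
Lemma label_approximation k (alpha : Omega m -> 'I_k) (e : R) :
  measurable_label alpha -> 0 < e ->
  exists (c : Omega m -> 'I_k) (N : nat) (D : set (Omega m)),
    [/\ forall x y, agree N x y -> c x = c y, measurable D,
      (rho D <= e%:E)%E & forall x, ~ D x -> alpha x = c x].
Proof.
move=> ma e0; have k0 : (0 < k)%N 
  by exact: leq_ltn_trans (leq0n _) (ltn_ord (alpha point)).
have ek : 0 < e / k%:R by rewrite divr_gt0// ltr0n.
have /choice[BD hBD] : forall i : 'I_k, exists BD : set (Omega m) * set (Omega m),
    [/\ cylindrical BD.1, measurable BD.2, (rho BD.2 <= (e / k%:R)%:E)%E &
      forall x, ~ BD.2 x -> (alpha x = i <-> BD.1 x)].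
  move=> i; have [B [D h]] := measurable_approximable _ (ma i) _ ek.
  by exists (B, D).
have /choice[Nf hN] : forall i, exists N, forall x y, agree N x y ->
    (BD i).1 x -> (BD i).1 y by move=> i; case: (hBD i).
pose N := (\max_i Nf i)%N.
pose c x := odflt (alpha point) [pick i | `[< (BD i).1 x >]].
exists c, N, (\big[setU/set0]_i (BD i).2); split.
- move=> x y xy; rewrite /c; congr (odflt _ _); apply: eq_pick => i.
  have xyi : agree (Nf i) x y by apply: agree_le xy; exact: leq_bigmax.
  by apply/asbool_equiv_eq; split; apply: hN => //; exact: agree_sym.
- by apply: bigsetU_measurable => i _; case: (hBD i).
- have sub (s : seq 'I_k) : (rho (\big[setU/set0]_(i <- s) (BD i).2) <=
      (\sum_(i <- s) e / k%:R)%:E)%E.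
    elim: s => [|i s IH]; first by rewrite !big_nil measure0.
    rewrite !big_cons EFinD; have [_ mDi Di _] := hBD i.
    apply: le_trans (measureU2 _ _ _) _ => //.
      by apply: bigsetU_measurable => j _; case: (hBD j).
    exact: leeD.
  apply: le_trans (sub _) _; rewrite lee_fin sumr_const card_ord -[leLHS]mulr_natr.
  by rewrite divfK// pnatr_eq0 -lt0n.
- move=> x; rewrite -bigcup_seq => nD.
  have AB i : alpha x = i <-> (BD i).1 x.
    have [_ _ _ h] := hBD i; apply: h => Dx; apply: nD; exists i => //=.
    by rewrite mem_index_enum.
  rewrite /c; case: pickP => [i /asboolP /AB//|/(_ (alpha x))].
  by move/asboolP => []; exact/AB.
Qed.

End approximation.

(** * Entropy is bounded by pressure *)

Section pressure_bound.
Context {R : realType} {m : nat}.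
Local Notation T := (@left_shift m).
Variable mu : probability (Omega m) R.
Hypothesis hmu : uniform_product mu.

Lemma law_word_uniform n w :
  law (fun f => \int[mu]_x f x) (word n) w = m.+1%:R ^- n.
Proof.
rewrite /law label_prob; last exact: measurable_word.
have -> : word n @^-1` [set w] =
    [set x : Omega m | forall i : 'I_n, x i \in [set w i]%SET].
  apply/seteqP; split => [x /= <- i|x /= h]; first by rewrite inE word_ith.
  by apply/ffunP => i; rewrite word_ith; have := h i; rewrite inE => /eqP.
rewrite (hmu n (fun i => [set w i]%SET))/=.
under eq_bigr do rewrite cards1 mul1r.
by rewrite prodr_const card_ord exprVn.
Qed.

(** Every word has mass $d^{-n}$ under the uniform product measure, so a sum over
    words is $d^n$ times an integral. *)
Lemma sum_words_le n (F : {ffun 'I_n -> 'I_m.+1} -> R) (G : Omega m -> R) :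
  bounded_measurable G -> (forall x, F (word n x) <= G x) ->
  \sum_w F w <= m.+1%:R ^+ n * \int[mu]_x G x.
Proof.
move=> mG FG; have mw := @measurable_word m n; have hJ := state_prob mu.
have d0 : 0 < m.+1%:R ^+ n :> R by rewrite exprn_gt0// ltr0n.
rewrite -ler_pdivrMl// mulr_sumr.
under eq_bigr => w _ do rewrite -(law_word_uniform n w).
have /= <- := state_label _ hJ (word n) F mw.
have /= h := state_le _ hJ; apply: h => //.
exact: bounded_measurable_label.
Qed.

Lemma expR_integral_gt0 (f : Omega m -> R) : bounded_measurable f ->
  0 < \int[mu]_x expR (f x).
Proof.
move=> mf; have hJ := state_prob mu; have [_ [M fM]] := mf.
apply: (@lt_le_trans _ _ (expR (- M))); first exact: expR_gt0.
rewrite -[leLHS](state_cst _ hJ).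
have /= h := state_le _ hJ; apply: h; first exact: bounded_measurable_cst.
  exact: bounded_measurable_expR.
by move=> x; rewrite ler_expR; have := fM x; rewrite ler_norml => /andP[].
Qed.

(** The variational principle for the pressure of [f], for an arbitrary
    partition. Read the labels of a point through a noisy channel: a word $w$ of
    letters is weighted by $e^{\phi(w)}$, with $\phi(w)$ the Birkhoff sum at a
    point of its cylinder, it produces the approximating labels $c_i(w)$, and each
    misread label costs a factor $e^{-M}$. Apply [gibbs_variational] to
    $V(a)=\ln\sum_w e^{\phi(w)}\prod_i e^{-M[a_i\ne c_i(w)]}$. Along an orbit $V$
    is at least the Birkhoff sum minus $M$ times the number of errors, and the
    total weight is at most $(1+ke^{-M})^n\sum_w e^{\phi(w)}$. *)
Lemma join_entropy_pressure (rho : probability (Omega m) R) k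
    (A : 'I_k -> set (Omega m)) (f : Omega m -> R) (e : R) :
  invariant_prob T rho -> measurable_partition A -> continuous f -> 0 < e ->
  exists N : nat, forall n,
    join_entropy T rho A n + n%:R * \int[rho]_x f x <=
    (n + N)%:R * ln m.+1%:R +
    ln (\int[mu]_x expR (\sum_(i < n) f (iter i T x))) + n%:R * e.
Proof.
move=> inv pA cf e0; have mT := @measurable_left_shift m.
have hrho := state_prob rho.
have [alpha ma AE] := partition_label _ _ pA.
have mf := continuous_bounded_measurable _ cf.
have e40 : 0 < e / 4 by rewrite divr_gt0.
(* [M] is the price of one misread label: large enough for the [k] possible
   misreadings of a letter to add little to the partition function. *)
have [M Mle] : exists M : R, k%:R * expR (- M) <= e / 4.
  exists (- ln (e / 4 / k.+1%:R)).
  rewrite opprK lnK ?posrE ?divr_gt0// mulrCA ger_pMr//.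
  by rewrite ler_pdivrMr// mul1r ler_nat.
have eM : 0 < e / 4 / (`|M| + 1) by rewrite divr_gt0// ltr_wpDl.
have [c [N1 [D [cN1 mD De alphac]]]] := label_approximation rho k alpha _ ma eM.
have [N2 fN2] := uniformly_continuous f _ cf e40.
pose N := maxn N1 N2; exists N => n.
have cN x y : agree N x y -> c x = c y.
  by move=> xy; apply: cN1; apply: agree_le xy; exact: leq_maxl.
have fN x y : agree N x y -> f x <= f y + e / 4.
  move=> xy; rewrite -lerBlDl; apply: le_trans (ler_norm _) _.
  by apply: fN2; apply: agree_le xy; exact: leq_maxr.
pose S x := \sum_(i < n) f (iter i T x).
have mS : bounded_measurable S.
  by apply: bounded_measurable_sum => i; exact: bounded_measurable_iter.
pose phi (w : {ffun 'I_(n + N) -> 'I_m.+1}) := S (extend _ w).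
have agree_iter x i : (i < n)%N ->
    agree N (iter i T x) (iter i T (extend _ (word (n + N) x))).
  move=> ni; apply: agree_shift; apply: (@agree_le _ _ (n + N)).
    by rewrite leq_add2r ltnW.
  exact: agree_extend.
have phi_le x : phi (word (n + N) x) <= S x + n%:R * (e / 4).
  rewrite /phi /S mulr_natl -[X in _ *+ X]card_ord -sumr_const -big_split/=.
  by apply: ler_sum => i _; apply/fN/agree_sym/agree_iter.
have le_phi x : S x - n%:R * (e / 4) <= phi (word (n + N) x).
  rewrite lerBlDr.
  rewrite /phi /S mulr_natl -[X in _ *+ X]card_ord -sumr_const -big_split/=.
  by apply: ler_sum => i _; apply/fN/agree_iter.
pose pen (a b : 'I_k) : R := M * (a != b)%:R.
pose q (a : {ffun 'I_n -> 'I_k}) : R := \sum_(w : {ffun 'I_(n + N) -> 'I_m.+1})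
  expR (phi w) * \prod_(i < n) expR (- pen (a i) (c (iter i T (extend _ w)))).
have term_ge0 a w : 0 <= expR (phi w) *
    \prod_(i < n) expR (- pen (a i) (c (iter i T (extend (n + N) w)))).
  by rewrite mulr_ge0 ?expR_ge0// prodr_ge0// => i _; exact: expR_ge0.
have q_ge (a : {ffun _}) x : expR (phi (word (n + N) x)
      - \sum_(i < n) pen (a i) (c (iter i T x))) <= q a.
  rewrite /q (bigD1 (word (n + N) x))//= expRD -sumrN [X in _ * X <= _]expR_sum.
  have -> : \prod_(i < n) expR (- pen (a i) (c (iter i T x))) = \prod_(i < n)
      expR (- pen (a i) (c (iter i T (extend _ (word (n + N) x))))).
    by apply: eq_bigr => i _; rewrite (cN _ _ (agree_iter x i (ltn_ord i))).
  by rewrite lerDl sumr_ge0.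
have q_gt0 a : 0 < q a by exact: lt_le_trans (expR_gt0 _) (q_ge a point).
(* The number of misread labels is at most the number of visits to [D], a
   Birkhoff sum, so its expectation is controlled by invariance. *)
pose h x := f x - e / 4 - `|M| * \1_D x.
have mh : bounded_measurable h.
  apply: bounded_measurableD; first apply: bounded_measurableD => //.
    exact: bounded_measurable_cst.
  rewrite (_ : (fun x => _) = fun x => - `|M| * \1_D x).
    exact/bounded_measurableZ/bounded_measurable_indic.
  by apply/funext => x; rewrite mulNr.
have V_ge x : \sum_(i < n) h (iter i T x) <= ln (q (block T alpha n x)).
  rewrite -[leLHS]expRK ler_ln ?posrE ?expR_gt0//.
  apply: le_trans (q_ge _ x); rewrite ler_expR.
  apply: (@le_trans _ _ (S x - n%:R * (e / 4)
      - \sum_(i < n) pen (block T alpha n x i) (c (iter i T x)))); last first.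
    by rewrite lerD2r le_phi.
  rewrite /S mulr_natl -[X in _ *+ X]card_ord -sumr_const -!sumrB.
  apply: ler_sum => i _; rewrite /h lerD2l lerN2 /pen ffunE.
  have [xD|xD] := boolP (iter i T x \in D).
    rewrite indicE xD mulr1; case: eqP => _; first by rewrite mulr0.
    by rewrite mulr1 ler_norm.
  rewrite alphac ?eqxx ?mulr0 ?mulr_ge0//.
  by move=> /mem_set; apply/negP.
have int_h : n%:R * (\int[rho]_x f x - e / 4 - e / 4) <=
    \int[rho]_x \sum_(i < n) h (iter i T x).
  rewrite invariant_integral_sum// ler_wpM2l//.
  have mI := bounded_measurable_indic D mD (R := R).
  rewrite /h (stateB _ hrho); last exact: bounded_measurableZ; last first.
    exact/bounded_measurableD/bounded_measurable_cst.
  rewrite (stateB _ hrho)//; last exact: bounded_measurable_cst.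
  rewrite (state_cst _ hrho) lerB// (stateZ _ hrho)//.
  rewrite /Rintegral integral_indic// setIT.
  apply: (@le_trans _ _ (`|M| * (e / 4 / (`|M| + 1)))).
    rewrite ler_wpM2l// -lee_fin fineK//; exact: fin_num_measure.
  rewrite mulrCA ger_pMr// ler_pdivrMr ?ltr_wpDl// mul1r lerDl//.
have sum_q : \sum_a q a <= (m.+1%:R ^+ (n + N) * (expR (n%:R * (e / 4)) *
    \int[mu]_x expR (S x))) * expR (n%:R * (e / 4)).
  rewrite /q exchange_big/=.
  apply: (@le_trans _ _ (\sum_w expR (phi w) * expR (n%:R * (e / 4)))).
    apply: ler_sum => w _; rewrite -mulr_sumr ler_wpM2l ?expR_ge0//.
    rewrite -(bigA_distr_bigA (fun (i : 'I_n) a =>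
      expR (- pen a (c (iter i T (extend (n + N) w))))))/=.
    rewrite expRM_natl -[X in _ ^+ X]card_ord -prodr_const.
    apply: ler_prod => i _; rewrite sumr_ge0/=; last by move=> a _; exact: expR_ge0.
    rewrite (bigD1 (c (iter i T (extend (n + N) w))))//=.
    rewrite /pen eqxx mulr0 oppr0 expR0.
    apply: le_trans (expR_ge1Dx _); rewrite lerD2l.
    apply: le_trans Mle.
    under eq_bigr => a /negPf ab do rewrite ab mulr1.
    rewrite sumr_const -[leLHS]mulr_natl ler_wpM2r ?expR_ge0// ler_nat.
    by rewrite -[X in (_ <= X)%N]card_ord max_card.
  rewrite -mulr_suml ler_wpM2r ?expR_ge0//.
  have -> : expR (n%:R * (e / 4)) * \int[mu]_x expR (S x) =
      \int[mu]_x (expR (n%:R * (e / 4)) * expR (S x)).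
    by rewrite (stateZ _ (state_prob mu))//; exact: bounded_measurable_expR.
  apply: sum_words_le.
    exact/bounded_measurableZ/bounded_measurable_expR.
  by move=> x; rewrite -expRD ler_expR addrC.
have mb := measurable_label_block T alpha n mT ma.
have := entropy_variational _ hrho (block T alpha n) (fun a => ln (q a)) mb.
under [X in _ <= ln X]eq_bigr do rewrite lnK ?posrE//.
rewrite -(join_entropyE T mT rho k A alpha n ma AE) => gibbs.
have hV : \int[rho]_x (\sum_(i < n) h (iter i T x)) <=
    \int[rho]_x ln (q (block T alpha n x)).
  have /= le_rho := state_le _ hrho; apply: le_rho => //.
    by apply: bounded_measurable_sum => i; exact: bounded_measurable_iter.
  exact: (bounded_measurable_label _ (fun a => ln (q a)) mb).
have Z0 : 0 < \int[mu]_x expR (S x) by exact: expR_integral_gt0.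
have d0 : 0 < m.+1%:R ^+ (n + N) :> R by rewrite exprn_gt0// ltr0n.
have sumq0 : 0 < \sum_a q a.
  rewrite (bigD1 (block T alpha n point))//= ltr_wpDr//.
  by rewrite sumr_ge0// => a _; exact: ltW.
have lnq : ln (\sum_a q a) <= (n + N)%:R * ln m.+1%:R +
    (n%:R * (e / 4) + ln (\int[mu]_x expR (S x))) + n%:R * (e / 4).
  apply: (@le_trans _ _ (ln ((m.+1%:R ^+ (n + N) * (expR (n%:R * (e / 4)) *
    \int[mu]_x expR (S x))) * expR (n%:R * (e / 4))))).
    by rewrite ler_ln ?posrE ?mulr_gt0 ?expR_gt0.
  set E := expR _; have E0 : E \in Num.pos by rewrite posrE expR_gt0.
  move: Z0 d0; rewrite -!posrE; set I := \int[mu]_x _ => I0 d0.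
  rewrite !lnM ?rpredM//.
  have -> : ln E = n%:R * (e / 4) by rewrite expRK.
  by rewrite lnXn// [_ * ln m.+1%:R]mulr_natl.
move: gibbs int_h hV lnq => /=; rewrite -/S; lra.
Qed.

End pressure_bound.

(** * Estimates for the mean-field weights *)

Lemma continuous_lincomb (R : realType) m (f g : Omega m -> R) (a c : R) :
  continuous f -> continuous g -> continuous (fun x => a * f x + c * g x).
Proof.
move=> cf cg x.
apply: (@continuousD R R (Omega m) (fun x => a * f x) (fun x => c * g x) x).
  by apply: (@continuousM R (Omega m) (fun=> a) f x);
     [exact: cst_continuous|exact: cf].
by apply: (@continuousM R (Omega m) (fun=> c) g x);
   [exact: cst_continuous|exact: cg].
Qed.

Lemma le_ln (R : realType) (x y : R) : 0 < x -> x <= y -> ln x <= ln y.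
Proof. by move=> x0 xy; rewrite ler_ln ?posrE//; exact: lt_le_trans xy. Qed.

Section mean_field_bounds.
Context {R : realType} {m : nat}.
Local Notation T := (@left_shift m).
Variable mu : probability (Omega m) R.
Hypothesis hmu : uniform_product mu.
Variables (g : Omega m -> R) (beta : R).
Hypotheses (cg : continuous g) (beta0 : 0 < beta).

Let weight (n : nat) x := expR (beta * n%:R / 2 * birkhoff T g n x ^+ 2).
Let Z n := \int[mu]_x weight n x.

Let mT : measurable_fun setT T := measurable_left_shift.
Let mg : bounded_measurable g := continuous_bounded_measurable _ cg.

Let mexponent n : bounded_measurable
  (fun x => beta * n%:R / 2 * birkhoff T g n x ^+ 2).
Proof.
apply: bounded_measurableZ; have mb := bounded_measurable_birkhoff T g n mT mg.
exact: (bounded_measurableM _ _ mb mb).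
Qed.

Let mweight n : bounded_measurable (weight n).
Proof. exact/bounded_measurable_expR/mexponent. Qed.

Let Z_gt0 n : 0 < Z n.
Proof. exact/expR_integral_gt0/mexponent. Qed.

(** Replace the square by its tangent line at $t=\rho(g)$:
    $\frac\beta2 b^2\ge\beta tb-\frac\beta2t^2$ with equality of the means, which
    reduces the claim to the pressure of $\beta tg-\frac\beta2t^2$. *)
Lemma partition_entropy_pressure (rho : probability (Omega m) R) k
    (A : 'I_k -> set (Omega m)) (e : R) :
  invariant_prob T rho -> measurable_partition A -> 0 < e ->
  exists n0, forall n, (n0 <= n)%N ->
    partition_entropy T rho A + beta / 2 * (\int[rho]_x g x) ^+ 2 <=
    ln m.+1%:R + n%:R^-1 * ln (Z n) + e.
Proof.
move=> inv pA e0; have e20 : 0 < e / 2 by rewrite divr_gt0.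
set t := \int[rho]_x g x; have hrho := state_prob rho.
pose f x := beta * t * g x - beta / 2 * t ^+ 2.
have cf : continuous f.
  rewrite (_ : f = fun x => beta * t * g x + -1 * (beta / 2 * t ^+ 2)).
    apply: (continuous_lincomb _ _ g (fun=> beta / 2 * t ^+ 2)) => //.
    by move=> x; exact: cst_continuous.
  by apply/funext => x; rewrite mulN1r.
have mf := continuous_bounded_measurable _ cf.
have [N hN] := join_entropy_pressure mu hmu rho k A f (e / 2) inv pA cf e20.
have int_f : \int[rho]_x f x = beta / 2 * t ^+ 2.
  rewrite /f (stateB _ hrho); last exact: bounded_measurable_cst; last first.
    exact: bounded_measurableZ.
  rewrite (state_cst _ hrho) (stateZ _ hrho)// -/t.
  by rewrite expr2; lra.
pose n0 := (Num.truncn (N%:R * ln m.+1%:R / (e / 2) : R)).+1.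
exists n0 => n n0n; have n0' : (0 < n)%N by exact: leq_trans n0n.
have nR : 0 < n%:R :> R by rewrite ltr0n.
have hn : N%:R * ln m.+1%:R <= n%:R * (e / 2).
  rewrite -ler_pdivrMr// ltW// (lt_le_trans (truncnS_gt _))//.
  by rewrite ler_nat.
have hZ : ln (\int[mu]_x expR (\sum_(i < n) f (iter i T x))) <= ln (Z n).
  have mS : bounded_measurable (fun x => \sum_(i < n) f (iter i T x)).
    by apply: bounded_measurable_sum => i; exact: bounded_measurable_iter.
  apply: (le_ln _ _ _ (expR_integral_gt0 mu _ mS)).
  have /= le_mu := state_le _ (state_prob mu); apply: le_mu => //.
    exact: bounded_measurable_expR.
  move=> x; rewrite ler_expR /f sumrB -mulr_sumr sumr_const card_ord.
  have -> : \sum_(i < n) g (iter i T x) = n%:R * birkhoff T g n x.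
    by rewrite /birkhoff mulVKf ?gt_eqF.
  set b := birkhoff _ _ _ _; rewrite -[X in _ - X]mulr_natl -subr_ge0.
  rewrite (_ : _ - _ = beta * n%:R / 2 * (b - t) ^+ 2); last by field.
  by rewrite mulr_ge0 ?sqr_ge0// divr_ge0// mulr_ge0// ltW.
have pe := partition_entropy_le T mT k A rho pA inv n n0'.
have := hN n; rewrite int_f natrD => main.
have {}pe : n%:R * partition_entropy T rho A <= join_entropy T rho A n.
  by rewrite -ler_pdivlMl.
rewrite -(ler_pM2l nR) !mulrDr [n%:R * (n%:R^-1 * _)]mulVKf ?gt_eqF//.
move: main; rewrite !mulrDl; lra.
Qed.

Lemma exists_ge_average (K : nat) (F : 'I_K.+1 -> R) (a : R) :
  \sum_i F i = a -> exists i, a / K.+1%:R <= F i.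
Proof.
move=> Fa; apply: contrapT => /forallNP h.
have : \sum_i F i < \sum_(i < K.+1) a / K.+1%:R.
  apply: ltr_sum => [|i _]; last by rewrite ltNge; apply/negP/h.
  by apply/hasP; exists ord0; rewrite ?mem_index_enum.
by rewrite Fa sumr_const card_ord -[X in _ < X]mulr_natr divfK// ltxx.
Qed.

(** Among the $O(n)$ level sets of the Birkhoff average of [g] in steps of $1/n$,
    one carries at least a $1/\mathrm{poly}(n)$ fraction of the mean-field mass and
    has a conditional mean of the average of [psi] at least that of the whole, up
    to $1/n$. Conditioned on it, the density with respect to [mu] is at most the
    weight at the mean of [g], divided by the total weight, up to a polynomial
    factor. As [mu] gives every word the mass $d^{-n}$, no word is likely, and the
    entropy of the first $n$ letters is large. The first summand of the error
    comes from the width of the cell, the two logarithms from its mass. *)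
Lemma mean_field_cell (psi : Omega m -> R) (B P : R) (n : nat) :
  continuous psi -> (forall x, `|g x| <= B) -> (forall x, `|psi x| <= P) ->
  (0 < n)%N ->
  exists2 J : (Omega m -> R) -> R, state J &
    (\int[mu]_x (birkhoff T psi n x * weight n x)) / Z n - n%:R^-1 <=
      J (birkhoff T psi n) /\
    n%:R * ln m.+1%:R + ln (Z n) - n%:R * (beta / 2 * J (birkhoff T g n) ^+ 2) -
      (beta * B + ln (2 * B * n%:R + 1) + ln (2 * P * n%:R + 1)) <=
      entropy J (word n).
Proof.
move=> cpsi gB psiP n0; set b := birkhoff T g n; set v := _ / Z n.
have hmuS := state_prob mu.
have nR : 0 < n%:R :> R by rewrite ltr0n.
have mpsi := continuous_bounded_measurable _ cpsi.
have mb : bounded_measurable b := bounded_measurable_birkhoff T g n mT mg.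
have mpn := bounded_measurable_birkhoff T psi n mT mpsi.
have bound (f : Omega m -> R) C : (forall x, `|f x| <= C) ->
    forall x, `|birkhoff T f n x| <= C.
  move=> fC x; rewrite /birkhoff normrM ger0_norm ?invr_ge0//.
  rewrite ler_pdivrMl// (le_trans (ler_norm_sum _ _ _))//.
  rewrite mulr_natl -[X in _ *+ X]card_ord -sumr_const ler_sum// => i _.
have bB := bound _ _ gB; have pnP := bound _ _ psiP.
have B0 : 0 <= B by exact: le_trans (normr_ge0 _) (gB point).
have P0 : 0 <= P by exact: le_trans (normr_ge0 _) (psiP point).
(* In steps of [1/n] the squared average moves by [O(1/n)], hence the exponent
   by [O(1)], while the number of cells stays linear in [n]. *)
pose h x := (b x + B) * n%:R.
have h0 x : 0 <= h x.
  by rewrite mulr_ge0//; have := bB x; rewrite ler_norml -/b; lra.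
pose K := Num.truncn (2 * B * n%:R).
have hK x : (Num.truncn (h x) < K.+1)%N.
  rewrite ltnS; apply: le_truncn; rewrite /h ler_wpM2r//.
  by have := bB x; rewrite ler_norml -/b; lra.
pose cell x : 'I_K.+1 := Ordinal (hK x).
have mcell : measurable_label cell.
  move=> c; have [mh _] : bounded_measurable h.
    rewrite /h; apply: bounded_measurableM; last exact: bounded_measurable_cst.
    by apply: bounded_measurableD => //; exact: bounded_measurable_cst.
  rewrite (_ : _ @^-1` _ = h @^-1` `[(c : nat)%:R, c.+1%:R[%classic).
    by rewrite -[_ @^-1` _]setTI; apply: mh => //; exact: measurable_itv.
  apply/seteqP; split => [x /= <-|x /=]; rewrite in_itv/=.
    by rewrite truncn_itv.
  by move=> /(truncn_def) hc; apply/val_inj.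
have cell_close x y : cell x = cell y -> b x <= b y + n%:R^-1.
  move=> /(congr1 val)/= xy.
  have /andP[_ hx] := truncn_itv (h0 x); have /andP[hy _] := truncn_itv (h0 y).
  have : h x < h y + 1 by rewrite (lt_le_trans hx)// xy -natr1 lerD2r.
  rewrite -(ler_pM2r nR) mulrDl mulVf ?gt_eqF// /h => /ltW; lra.
pose D c x := (cell x == c)%:R * weight n x.
have mD c : bounded_measurable (D c).
  by apply: bounded_measurableM => //; exact: (bounded_measurable_label _ (fun a => (a == c)%:R)).
have D0 c x : 0 <= D c x by rewrite mulr_ge0// expR_ge0.
have mpD c : bounded_measurable (fun x => birkhoff T psi n x * D c x).
  exact: bounded_measurableM.
have sumD (f : Omega m -> R) x : \sum_c f x * D c x = f x * weight n x.
  rewrite (bigD1 (cell x))//= /D eqxx mul1r big1 ?addr0// => c.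
  by rewrite eq_sym => /negPf ->; rewrite mul0r mulr0.
pose w c := (\int[mu]_x D c x) / Z n.
pose s c := (\int[mu]_x (birkhoff T psi n x * D c x)) / Z n.
have sumw : \sum_c w c = 1.
  rewrite -mulr_suml -(divff (lt0r_neq0 (Z_gt0 n))); congr (_ / _).
  have /= <- := state_sum _ hmuS _ (index_enum _) D mD; congr (\int[mu]_x _).
  by apply/funext => x; have /= := sumD (fun=> 1) x;
    under eq_bigr do rewrite mul1r; rewrite mul1r.
have sums : \sum_c s c = v.
  rewrite -mulr_suml; congr (_ / _).
  have /= <- := state_sum _ hmuS _ (index_enum _) _ mpD; congr (\int[mu]_x _).
  by apply/funext => x; exact: sumD.
have sw c : s c <= P * w c.
  rewrite mulrA ler_wpM2r ?invr_ge0 ?(ltW (Z_gt0 n))//.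
  rewrite -(stateZ _ hmuS)//; have /= le_mu := state_le _ hmuS; apply: le_mu => //.
    exact: bounded_measurableZ.
  by move=> x; rewrite ler_wpM2r// (le_trans (ler_norm _)).
have vP : `|v| <= P.
  have hS := state_density mu (weight n) (mweight n)
    (fun x => expR_ge0 _) (Z_gt0 n).
  exact: (state_bound _ hS _ P mpn pnP).
set eta := n%:R^-1 in vP *; have eta0 : 0 < eta by rewrite invr_gt0.
have sumeta : \sum_c (s c - (v - eta) * w c) = eta.
  by rewrite sumrB -mulr_sumr sums sumw mulr1 subKr.
(* A cell good for both purposes: averaging the excess of its mean over
   [v - eta] also keeps its mass away from 0. *)
have [c hc] := exists_ge_average K _ eta sumeta.
have wc : eta / K.+1%:R <= (2 * P + eta) * w c.
  apply: le_trans hc _; have := sw c.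
  have wc0 : 0 <= w c.
    apply: divr_ge0; last exact: ltW.
    by apply: (state_ge0 _ hmuS) => //; exact: D0.
  have : (P - v) * w c <= (2 * P) * w c.
    by rewrite ler_wpM2r//; move: vP; rewrite ler_norml; lra.
  rewrite !mulrDl !mulNr; lra.
have P2eta : 0 < 2 * P + eta by rewrite ltr_wpDl// mulr_ge0.
pose A1 := 2 * B * n%:R + 1; pose A2 := 2 * P * n%:R + 1.
have A10 : 0 < A1 by rewrite ltr_wpDl// !mulr_ge0.
have A20 : 0 < A2 by rewrite ltr_wpDl// !mulr_ge0.
have wA : (A1 * A2)^-1 <= w c.
  rewrite -(ler_pM2l P2eta); apply: le_trans wc.
  have -> : (2 * P + eta) * (A1 * A2)^-1 = eta * A1^-1.
    rewrite /eta /A2 invfM mulrCA mulrC; congr (_ * _).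
    have A20' : 2 * P * n%:R + 1 != 0 by exact: lt0r_neq0.
    by field; rewrite A20' gt_eqF.
  rewrite ler_pM2l// lef_pV2 ?posrE ?ltr0n//.
  rewrite /A1 -natr1 lerD2r truncn_le//.
  by rewrite !mulr_ge0.
have w0 : 0 < w c by apply: lt_le_trans wA; rewrite invr_gt0 mulr_gt0.
pose I := \int[mu]_x D c x.
have wI : w c = I / Z n by [].
have I0 : 0 < I by move: w0; rewrite wI pmulr_lgt0// invr_gt0.
pose J f := (\int[mu]_x (f x * D c x)) / I.
have hJ : state J by exact: state_density (mD c) (D0 c) I0.
have J_le f1 f2 : bounded_measurable f1 -> bounded_measurable f2 ->
    (forall x, cell x = c -> f1 x <= f2 x) -> J f1 <= J f2.
  move=> m1 m2 f12; rewrite /J ler_wpM2r ?invr_ge0 ?(ltW I0)//.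
  have /= le_mu := state_le _ hmuS; apply: le_mu.
  - exact: bounded_measurableM.
  - exact: bounded_measurableM.
  - move=> x; rewrite /D; case: eqP => [/f12 f12x|_].
      by rewrite mul1r ler_wpM2r// expR_ge0.
    by rewrite mul0r !mulr0.
pose gc := J b.
have gcB : `|gc| <= B by exact: (state_bound _ hJ _ B mb bB).
have b_close x : cell x = c -> `|b x - gc| <= eta.
  move=> xc; rewrite ler_norml; apply/andP; split.
    rewrite lerBrDr addrC lerBlDr -(state_cst _ hJ (b x + eta)).
    apply: J_le => // [|y yc]; first exact: bounded_measurable_cst.
    by apply: cell_close; rewrite yc.
  rewrite lerBlDl -lerBlDr -(state_cst _ hJ (b x - eta)).
  apply: J_le => // [|y yc]; first exact: bounded_measurable_cst.
  by rewrite lerBlDr; apply: cell_close; rewrite yc.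
pose M := n%:R * (beta / 2 * gc ^+ 2) + beta * B.
have weight_le x : cell x = c -> weight n x <= expR M.
  move=> xc; rewrite ler_expR -/b /M.
  have h1 : n%:R * (b x ^+ 2 - gc ^+ 2) <= 2 * B.
    rewrite subr_sqr mulrA (le_trans (ler_norm _))// normrM -[leRHS]mul1r.
    rewrite ler_pM//.
      rewrite normrM ger0_norm// -ler_pdivlMl// mulr1; exact: b_close.
    by rewrite (le_trans (ler_normD _ _))// mulrDl mul1r lerD// bB.
  have : beta / 2 * (n%:R * (b x ^+ 2 - gc ^+ 2)) <= beta / 2 * (2 * B).
    by rewrite ler_pM2l// divr_gt0.
  lra.
pose kappa := expR M / (m.+1%:R ^+ n * I).
have d0 : 0 < m.+1%:R ^+ n :> R by rewrite exprn_gt0// ltr0n.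
have kappa0 : 0 < kappa by rewrite divr_gt0 ?expR_gt0// mulr_gt0.
have mw := @measurable_word m n.
have law_le u : law J (word n) u <= kappa.
  rewrite /kappa invfM mulrA ler_wpM2r ?invr_ge0 ?(ltW I0)//.
  rewrite -(law_word_uniform mu hmu n u) /law.
  have mu1 : bounded_measurable (fun x => (word n x == u)%:R : R).
    exact: (bounded_measurable_label _ (fun a => (a == u)%:R)).
  rewrite -(stateZ _ hmuS)//; have /= le_mu := state_le _ hmuS; apply: le_mu.
  - exact: bounded_measurableM.
  - exact: bounded_measurableZ.
  - move=> x; rewrite mulrC ler_wpM2r// /D.
    case: eqP => [/weight_le wx|_]; first by rewrite mul1r.
    by rewrite mul0r expR_ge0.
have entropy_ge : - ln kappa <= entropy J (word n).
  rewrite /entropy lerN2 -[leRHS]mul1r -(sum_law _ hJ _ mw) mulr_suml.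
  apply: ler_sum => u _; have := law_ge0 _ hJ (word n) u mw.
  rewrite le_eqVlt => /predU1P[<-|u0]; first by rewrite !mul0r.
  by rewrite ler_pM2l//; exact: le_ln.
exists J => //; split.
  rewrite -(ler_pM2r w0).
  have -> : J (birkhoff T psi n) * w c = s c.
    by rewrite wI /J mulrA divfK// gt_eqF.
  rewrite -subr_ge0; apply: le_trans hc.
  by rewrite divr_ge0// ltW.
apply: le_trans entropy_ge.
have lnk : ln kappa = M - (n%:R * ln m.+1%:R + (ln (w c) + ln (Z n))).
  rewrite /kappa ln_div ?posrE ?expR_gt0 ?mulr_gt0// expRK.
  rewrite lnM ?posrE// lnXn// mulr_natl.
  have -> : I = w c * Z n by rewrite wI divfK// gt_eqF.
  by rewrite lnM ?posrE.
have lnw : - (ln A1 + ln A2) <= ln (w c).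
  rewrite -lnM ?posrE// -lnV ?posrE ?mulr_gt0//; apply: le_ln wA.
  by rewrite invr_gt0 mulr_gt0.
rewrite lnk /M -/A1 -/A2 -/b -/gc; lra.
Qed.

End mean_field_bounds.

(** * Ultralimits of states *)

Section ultralimit.
Context {R : realType}.

Lemma ultra_fmap (I S : Type) (U : set_system I) (x : I -> S) :
  UltraFilter U -> UltraFilter (x @ U).
Proof.
move=> UU; have PU : ProperFilter U by exact: ultra_proper.
split; first exact: fmap_proper_filter.
move=> G GG sub; apply/seteqP; split => A; last exact: sub.
move=> GA; have [//|UnA] := in_ultra_setVsetC (x @^-1` A) UU.
have GnA : G (~` A) by exact: sub.
by exfalso; apply: (@filter_not_empty _ G GG); rewrite -(setICr A); exact: filterI.
Qed.

Lemma ultra_bounded_cvg (I : Type) (U : set_system I) (x : I -> R) (M : R) :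
  UltraFilter U -> (forall k, `|x k| <= M) -> cvg (x @ U).
Proof.
move=> UU xM; have := @segment_compact R (- M) M; rewrite compact_ultra.
move=> /(_ _ (ultra_fmap _ _ _ x UU)) [|l [_ xl]]; last by apply/cvg_ex; exists l.
have PU : ProperFilter U by exact: ultra_proper.
apply: (@filterE _ U) => k.
by rewrite /preimage/= in_itv/= -ler_norml; exact: xM.
Qed.

End ultralimit.

Section state_limit.
Context {d : measure_display} {X : measurableType d} {R : realType}.
Variables (U : set_system nat) (L : nat -> (X -> R) -> R).
Hypotheses (UU : UltraFilter U) (hL : forall k, state (L k)).

Definition state_limit (f : X -> R) : R := lim (L k f @[k --> U]).

Let PU : ProperFilter U.
Proof. exact: ultra_proper. Qed.

Lemma state_limit_cvg f : bounded_measurable f ->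
  L k f @[k --> U] --> state_limit f.
Proof.
move=> mf; have [_ [M fM]] := mf.
by apply: (ultra_bounded_cvg _ _ _ M) => // k; exact: (state_bound _ (hL k)).
Qed.

Lemma state_state_limit : state state_limit.
Proof.
split.
- rewrite /state_limit (_ : (fun k => L k (fun=> 1)) = fun=> 1).
    exact: lim_cst.
  by apply/funext => k; exact: state1.
- move=> f g mf mg; apply: cvg_lim => //.
  have h := cvgD (state_limit_cvg _ mf) (state_limit_cvg _ mg).
  suff -> : (fun k => L k (fun x => f x + g x)) = (fun k => L k f + L k g) by exact: h.
  by apply/funext => k; rewrite (stateD _ (hL k)).
- move=> c f mf; apply: cvg_lim => //.
  have h : c * L k f @[k --> U] --> c * state_limit f.
    by apply: cvgMr; exact: state_limit_cvg.
  suff -> : (fun k => L k (fun x => c * f x)) = (fun k => c * L k f) by exact: h.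
  by apply/funext => k; rewrite (stateZ _ (hL k)).
- move=> f g mf mg fg.
  have := @ler_cvg_to nat U PU R (L ^~ f) (L ^~ g) _ _ (state_limit_cvg _ mf)
    (state_limit_cvg _ mg); apply.
  by apply: (@filterE _ U) => k; exact: (state_le _ (hL k)).
Qed.

(** The entropy lies below affine functions of the law, given by the supporting
    lines of $-p\ln p$ at the limit masses, and these converge. At a limit mass 0
    there is no supporting line, and the one at a small [e'] is taken. *)
Lemma entropy_upper_semicontinuous (K : finType) (alpha : X -> K) (e : R) :
  measurable_label alpha -> 0 < e ->
  \forall k \near U, entropy (L k) alpha <= entropy state_limit alpha + e.
Proof.
move=> ma e0; have hS := state_state_limit; set S := state_limit.
have K0 : 0 < #|K|%:R + 1 :> R by rewrite ltr_wpDl.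
pose e' := e / 2 / (#|K|%:R + 1); have e'0 : 0 < e' by rewrite !divr_gt0.
pose r a := if law S alpha a == 0 then e' else law S alpha a.
have r0 a : 0 < r a.
  rewrite /r; case: eqVneq => // p0.
  by rewrite lt_def p0 (law_ge0 _ hS).
pose bnd (p : K -> R) := \sum_a (r a - p a - p a * ln (r a)).
have le_bnd k : entropy (L k) alpha <= bnd (law (L k) alpha).
  rewrite /entropy -sumrN; apply: ler_sum => a _.
  have := ln_gap_le _ _ (law_ge0 _ (hL k) alpha a ma) (ltW (r0 a)) (fun=> r0 a).
  rewrite mulrBr; lra.
have bndS : bnd (law S alpha) <= entropy S alpha + e / 2.
  have -> : bnd (law S alpha) = entropy S alpha +
      \sum_a (r a - law S alpha a - law S alpha a * (ln (r a) - ln (law S alpha a))).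
    by rewrite /entropy addrC -sumrB; apply: eq_bigr => a _; rewrite mulrBr; lra.
  rewrite lerD2l; apply: (@le_trans _ _ (\sum_(a : K) e')).
    apply: ler_sum => a _; rewrite /r; case: eqVneq => [->|_].
      by rewrite mul0r !subr0.
    by rewrite !subrr mulr0 subr0 ltW.
  rewrite sumr_const -[leLHS]mulr_natl /e' mulrCA ger_pMr ?divr_gt0//.
  by rewrite ler_pdivrMr// mul1r lerDl.
have cvg_bnd : bnd (law (L k) alpha) @[k --> U] --> bnd (law S alpha).
  apply: cvg_big => [|a _]; first exact: add_continuous.
  have cl : law (L k) alpha a @[k --> U] --> law S alpha a.
    apply: state_limit_cvg.
    exact: (bounded_measurable_label _ (fun b => (b == a)%:R)).
  by apply: cvgB; [apply: cvgB => //; exact: cvg_cst|exact: cvgMl].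
have e20 : 0 < e / 2 by rewrite divr_gt0.
have /cvgrPdist_le/(_ _ e20) := cvg_bnd.
apply: (@filterS _ U) => k; rewrite distrC => h; apply: le_trans (le_bnd k) _.
have := le_trans (ler_norm _) h; lra.
Qed.

End state_limit.

Section shift_invariance.
Context {d : measure_display} {X : measurableType d} {R : realType}.
Variable T : X -> X.
Hypothesis mT : measurable_fun setT T.

Lemma birkhoff_shift (f : X -> R) (C : R) n x : (forall y, `|f y| <= C) ->
  `|birkhoff T (fun y => f (T y)) n x - birkhoff T f n x| <= 2 * C / n%:R.
Proof.
move=> fC; rewrite /birkhoff -mulrBr -sumrB normrM ger0_norm ?invr_ge0//.
rewrite mulrC ler_wpM2r ?invr_ge0//.
under eq_bigr do rewrite -iterS.
rewrite -(big_mkord xpredT (fun i => f (iter i.+1 T x) - f (iter i T x))).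
rewrite telescope_sumr// (le_trans (ler_normB _ _))// mulrDl mul1r.
by rewrite lerD.
Qed.

Lemma state_birkhoff_shift J (f : X -> R) (C : R) n : state J -> (0 < n)%N ->
  bounded_measurable f -> (forall y, `|f y| <= C) ->
  `|J (birkhoff T (fun y => f (T y)) n) - J (birkhoff T f n)| <= 2 * C / n%:R.
Proof.
move=> hJ n0 mf fC; apply: (state_dist _ hJ).
- exact/bounded_measurable_birkhoff/bounded_measurable_comp.
- exact: bounded_measurable_birkhoff.
- by move=> x; exact: birkhoff_shift.
Qed.

End shift_invariance.

Lemma continuous_comp_shift (R : realType) m (f : Omega m -> R) :
  continuous f -> continuous (fun x => f (left_shift x)).
Proof.
move=> /continuous_agree cf; apply/continuous_agree => x e e0.
have [N hN] := cf (left_shift x) e e0; exists N.+1 => y xy.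
by apply: hN => n nN; exact: xy.
Qed.

Lemma invariant_of_continuous (R : realType) m (rho : probability (Omega m) R) :
  (forall f : Omega m -> R, continuous f ->
    \int[rho]_x f (left_shift x) = \int[rho]_x f x) ->
  invariant_prob (@left_shift m) rho.
Proof.
move=> h; pose T : {mfun Omega m >-> Omega m} :=
  HB.pack (@left_shift m) (isMeasurableFun.Build _ _ _ _ _ (@measurable_left_shift m)).
apply: (probability_unique (distribution rho T) rho) => f cf.
have mf := continuous_bounded_measurable _ cf; have [m_f _] := mf.
rewrite -h// /Rintegral; congr fine.
rewrite (@integral_pushforward _ _ _ _ _ _ (@measurable_left_shift m) rho setT (EFin \o f))//.
- exact/measurable_EFinP.
- apply: (bounded_measurable_integrable rho (fun x => f (left_shift x))).
  exact: (bounded_measurable_comp _ _ measurable_left_shift).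
Qed.

(** * Equilibria above a mean-field limit *)

Lemma near_infty_seq (s : nat -> nat) (P : nat -> Prop) :
  {homo s : i j / (i < j)%N} -> (exists n0, forall n, (n0 <= n)%N -> P n) ->
  \forall k \near \oo, P (s k).
Proof.
move=> hs [n0 hP]; exists n0 => // k /= n0k; apply: hP.
apply: (leq_trans n0k); elim: k {n0k} => // k IH.
exact: leq_ltn_trans IH (hs _ _ (ltnSn k)).
Qed.

Lemma natr_unbounded (R : realType) (c e : R) : 0 < e ->
  exists n0, forall n, (n0 <= n)%N -> c <= n%:R * e.
Proof.
move=> e0; exists (Num.truncn (c / e)).+1 => n n0n.
rewrite -ler_pdivrMr// ltW// (lt_le_trans (truncnS_gt _))//.
by rewrite ler_nat.
Qed.

Lemma ln_affine_sublinear (R : realType) (c e : R) : 0 <= c -> 0 < e ->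
  exists n0, forall n, (n0 <= n)%N -> ln (c * n%:R + 1) <= n%:R * e.
Proof.
move=> c0 e0; have e20 : 0 < e / 2 by rewrite divr_gt0.
pose A := (c + 1) / (e / 2).
have c1 : 0 < c + 1 by rewrite ltr_wpDl.
have A0 : 0 < A by rewrite divr_gt0.
have [n0 hn0] := natr_unbounded R (ln A) (e / 2) e20.
exists n0.+1 => n n0n; have n1 : (1 <= n)%N by exact: leq_trans n0n.
have y0 : 0 < c * n%:R + 1 by rewrite ltr_wpDl// mulr_ge0.
have -> : c * n%:R + 1 = (c * n%:R + 1) / A * A by rewrite divfK// gt_eqF.
rewrite lnM ?posrE ?divr_gt0//.
have h1 := hn0 n (ltnW n0n).
have h2 : (c * n%:R + 1) / A <= n%:R * (e / 2).
  rewrite ler_pdivrMr// /A -mulrA [e / 2 * _]mulrC divfK ?gt_eqF//.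
  by rewrite [leRHS]mulrC mulrDl mul1r lerD2l ler1n.
have := ln_sublinear (divr_gt0 y0 A0); lra.
Qed.

Section equilibria.
Context {R : realType} {m : nat}.
Local Notation T := (@left_shift m).
Variable mu : probability (Omega m) R.
Hypothesis hmu : uniform_product mu.
Variables (g : Omega m -> R) (beta : R).
Hypotheses (cg : continuous g) (beta0 : 0 < beta).

Let mT : measurable_fun setT T := measurable_left_shift.

Definition letter_cell (i : 'I_m.+1) : set (Omega m) := letter @^-1` [set i].

Lemma letter_partition : measurable_partition letter_cell.
Proof.
split; first exact: measurable_letter.
  by move=> i j _ _ [x [/= <- <-]].
by apply/seteqP; split => // x _; exists (letter x).
Qed.

Lemma mean_field_equilibrium_cvg (nu : probability (Omega m) R)
    (s : nat -> nat) (psi : Omega m -> R) : continuous psi ->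
  mean_field mu g beta (s k) @[k --> \oo] --> expectation_on_C nu ->
  (\int[mu]_x (birkhoff T psi (s k) x *
     expR (beta * (s k)%:R / 2 * birkhoff T g (s k) x ^+ 2))) /
  (\int[mu]_x expR (beta * (s k)%:R / 2 * birkhoff T g (s k) x ^+ 2))
    @[k --> \oo] --> \int[nu]_x psi x.
Proof.
move=> cpsi cv; pose psi' : continuousType (Omega m) R := mkcts cpsi.
have := @proj_continuous (continuousType (Omega m) R) (fun=> R) psi'
  (expectation_on_C nu).
exact: (cvg_comp _ _ cv).
Qed.

(** A maximizer whose entropy is that of the partition by the first letter. In
    this form maximality involves real numbers only, and it is inherited by the
    components of a mixture. *)
Definition letter_maximizer (rho : probability (Omega m) R) :=
  invariant_prob T rho /\
  forall (nu : probability (Omega m) R) k (A : 'I_k -> set (Omega m)),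
    invariant_prob T nu -> measurable_partition A ->
    partition_entropy T nu A + beta / 2 * (\int[nu]_x g x) ^+ 2 <=
    partition_entropy T rho letter_cell + beta / 2 * (\int[rho]_x g x) ^+ 2.

Lemma letter_maximizer_equilibrium (rho : probability (Omega m) R) :
  letter_maximizer rho -> quadratic_equilibrium g beta rho.
Proof.
move=> [inv h]; split => //; apply/eqP; rewrite eq_le; apply/andP; split.
  by apply: ereal_sup_ubound; exists rho.
apply: ge_ereal_sup => _ [nu inu <-]; rewrite /quadratic_pressure.
apply: (@le_trans _ _ ((beta / 2 * (\int[nu]_x g x) ^+ 2)%:E +
  (partition_entropy T rho letter_cell + beta / 2 * (\int[rho]_x g x) ^+ 2 -
   beta / 2 * (\int[nu]_x g x) ^+ 2)%:E)%E).
  apply: leeD2l; apply: ge_ereal_sup => _ [l [B [pB ->]]].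
  by rewrite lee_fin lerBrDr; exact: h.
rewrite -EFinD addrC subrK addrC EFinD; apply: leeD2l.
exact/partition_entropy_le_ks/letter_partition.
Qed.

(** Restrict the mean-field weights along the given subsequence to the cells of
    [mean_field_cell], average along orbits, and take a limit along an
    ultrafilter. Invariance holds because a shift changes orbit averages by
    $O(1/n)$. For every block length $q$, [entropy_block_average] and upper
    semicontinuity carry the lower bound on the entropy to the limit $\rho$, giving
    $\frac1qH_q(\rho)+\frac\beta2\rho(g)^2\ge\ln d+\frac1n\ln Z_n-o(1)$ for some
    arbitrarily large $n$, and [partition_entropy_pressure] bounds the right hand
    side below by the free energy of any competitor. *)
Lemma exists_maximizer_ge (nu : probability (Omega m) R) (psi : Omega m -> R) :
  mean_field_equilibrium mu g beta nu -> continuous psi ->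
  exists2 rho, letter_maximizer rho &
    \int[nu]_x psi x <= \int[rho]_x psi x.
Proof.
move=> [s0 hs0 cvs0] cpsi.
(* [s0 0] may be 0, where the averages degenerate. *)
pose s k := s0 k.+1.
have hs : {homo s : i j / (i < j)%N} by move=> i j ij; exact: hs0.
have s_gt0 k : (0 < s k)%N by exact: leq_ltn_trans (hs0 _ _ (ltn0Sn k)).
have cvs : mean_field mu g beta (s k) @[k --> \oo] --> expectation_on_C nu.
  have succ_oo : S k @[k --> \oo] --> \oo.
    by move=> A [N _ NA]; exists N => // k Nk; apply: NA; exact: leqW.
  exact: (cvg_comp _ _ succ_oo cvs0).
have cvpsi := mean_field_equilibrium_cvg nu s psi cpsi cvs.
have mg := continuous_bounded_measurable g cg; have [_ [B gB]] := mg.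
have mpsi := continuous_bounded_measurable psi cpsi; have [_ [P psiP]] := mpsi.
have B0 : 0 <= B by exact: le_trans (normr_ge0 _) (gB point).
have P0 : 0 <= P by exact: le_trans (normr_ge0 _) (psiP point).
have /choice[J hJ] : forall k, exists J : (Omega m -> R) -> R, state J /\ _ :=
  fun k => let: ex_intro2 J hJ h :=
    mean_field_cell mu hmu g beta cg beta0 psi B P (s k) cpsi gB psiP (s_gt0 k)
  in ex_intro _ J (conj hJ h).
have [U [UU sU]] := ultraFilterLemma (@eventually_filter).
have PU : ProperFilter U by exact: ultra_proper.
pose L k f := J k (birkhoff T f (s k)).
have hL k : state (L k).
  by apply: state_birkhoff => //; have [] := hJ k.
pose S := state_limit U L.
have hS : state S := state_state_limit U L UU hL.
have cvL f (mf : bounded_measurable f) := state_limit_cvg U L UU hL f mf.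
have [rho rhoE] := state_representation S hS.
have near_s P' : (exists n0, forall n, (n0 <= n)%N -> P' n) ->
    \forall k \near U, P' (s k).
  by move=> h; apply: sU; exact: near_infty_seq.
have inv : invariant_prob T rho.
  apply: invariant_of_continuous => f cf.
  rewrite rhoE ?rhoE//; last exact: continuous_comp_shift.
  have mf := continuous_bounded_measurable f cf; have [_ [C fC]] := mf.
  have mfT := bounded_measurable_comp T f mT mf.
  apply/eqP; rewrite -subr_eq0 -normr_le0; apply/ler_addgt0Pl => e e0.
  rewrite addr0.
  have cvd : `|L k (fun x => f (T x)) - L k f| @[k --> U] -->
      `|S (fun x => f (T x)) - S f|.
    by apply: cvg_norm; apply: cvgB; exact: cvL.
  have := @ler_cvg_to nat U PU R _ (fun=> e) _ _ cvd (@cvg_cst _ _ _ _ _); apply.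
  have /near_s := natr_unbounded R (2 * C) e e0.
  apply: (@filterS _ U) => k hk.
  apply: (le_trans (state_birkhoff_shift T mT (J k) f C (s k) _ _ mf fC)) => //.
    by have [] := hJ k.
  by rewrite /= ler_pdivrMr ?ltr0n ?s_gt0// [leRHS]mulrC.
exists rho; last first.
  rewrite (rhoE psi cpsi).
  have cvU : _ @[k --> U] --> \int[nu]_x psi x := cvg_trans (cvg_app _ sU) cvpsi.
  apply/ler_addgt0Pl => e e0.
  have cvr : e + L k psi @[k --> U] --> e + S psi.
    by apply: cvgD; [exact: cvg_cst|exact: cvL].
  have := @ler_cvg_to nat U PU R _ _ _ _ cvU cvr; apply.
  have /near_s := natr_unbounded R 1 e e0.
  apply: (@filterS _ U) => k hk; have [_ [h _]] := hJ k.
  rewrite /= addrC -lerBlDr; apply: le_trans h; rewrite lerD2l lerN2.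
  by rewrite -[leLHS]mul1r ler_pdivrMr ?ltr0n ?s_gt0// [leRHS]mulrC.
split => // rho' l A inv' pA.
set F' := _ + _ * _ ^+ 2.
have key q e : (0 < q)%N -> 0 < e -> F' <=
    q%:R^-1 * join_entropy T rho letter_cell q + beta / 2 * (\int[rho]_x g x) ^+ 2
    + e * (6 + q%:R^-1).
  move=> q0 e0; have qR : 0 < q%:R :> R by rewrite ltr0n.
  have mw := @measurable_word m q.
  have -> : join_entropy T rho letter_cell q = entropy S (word q).
    rewrite (join_entropyE T mT rho _ letter_cell letter q) //;
      last exact: measurable_letter.
    congr (- _); apply: eq_bigr => w _.
    suff -> : law (fun f => \int[rho]_x f x) (block T letter q) w =
        law S (word q) w by [].
    rewrite !law_word_indic rhoE//; apply: continuous_indic_cylindrical.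
    by exists q => x y xy /= <-; exact/esym/word_agree.
  rewrite (rhoE g cg); set H := entropy S _; set c := S g.
  have Lg_near : \forall k \near U, beta / 2 * L k g ^+ 2 <= beta / 2 * c ^+ 2 + e.
    have cvg2 : beta / 2 * (L k g * L k g) @[k --> U] --> beta / 2 * (c * c).
      by apply: cvgMr; apply: cvgM; exact: cvL.
    have /cvgrPdist_le/(_ _ e0) := cvg2; apply: (@filterS _ U) => k.
    by rewrite distrC !expr2 => /(le_trans (ler_norm _)); rewrite lerBlDl.
  have ent_near := entropy_upper_semicontinuous U L UU hL _ (word q) e mw e0.
  have qe0 : 0 < q%:R * e by rewrite mulr_gt0.
  have n1 := near_s _ (partition_entropy_pressure mu hmu g beta cg beta0
    rho' l A e inv' pA e0).
  have n2 := near_s _ (natr_unbounded R (beta * B) e e0).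
  have n3 := near_s _ (ln_affine_sublinear R (2 * B) e (mulr_ge0 (ler0n _ 2) B0) e0).
  have n4 := near_s _ (ln_affine_sublinear R (2 * P) e (mulr_ge0 (ler0n _ 2) P0) e0).
  have n5 := near_s (fun n => (q <= n)%N) (ex_intro _ q (fun n qn => qn)).
  have n6 := near_s _ (natr_unbounded R (2 * q%:R ^+ 2 * ln m.+1%:R) _ qe0).
  have [k [[[h1 h2] [h3 h4]] [[h5 h6] [h7 h8]]]] := @filter_ex _ U PU _
    (filterI (filterI (filterI n1 n2) (filterI n3 n4))
             (filterI (filterI n5 n6) (filterI ent_near Lg_near))).
  have [hJk [_ hent]] := hJ k.
  have avg := entropy_block_average T _ letter mT measurable_letter (J k) hJk q (s k) q0 h5.
  rewrite card_ord in avg.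
  have nR : 0 < (s k)%:R :> R by rewrite ltr0n.
  set n : R := (s k)%:R in h1 h2 h3 h4 h6 hent avg nR *.
  set lnZ := ln (\int[mu]_x _) in h1 hent.
  have nlnZ : n * (ln m.+1%:R + n^-1 * lnZ + e) = n * ln m.+1%:R + lnZ + n * e.
    by rewrite !mulrDr mulVKf ?gt_eqF.
  rewrite -/F' in h1; rewrite -/S -/H in h7.
  rewrite -(ler_pM2l nR) nlnZ -(ler_pM2l qR) in h1.
  rewrite -(ler_pM2l nR) in h7; rewrite -(ler_pM2l nR) -(ler_pM2l qR) in h8.
  rewrite -(ler_pM2l qR) in h2; rewrite -(ler_pM2l qR) in h3.
  rewrite -(ler_pM2l qR) in h4; rewrite -(ler_pM2l qR) in hent.
  rewrite -(ler_pM2l nR) -(ler_pM2l qR).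
  have -> : q%:R * (n * (q%:R^-1 * H + beta / 2 * c ^+ 2 + e * (6 + q%:R^-1))) =
      n * H + q%:R * (n * (beta / 2 * c ^+ 2)) + 6 * (q%:R * (n * e)) + n * e.
    by field; rewrite gt_eqF.
  have {}avg : q%:R * entropy (J k) (word (s k)) <=
      n * entropy (L k) (word q) + 2 * q%:R ^+ 2 * ln m.+1%:R by exact: avg.
  have {}hent : q%:R * (n * ln m.+1%:R + lnZ - n * (beta / 2 * L k g ^+ 2) -
      (beta * B + ln (2 * B * n + 1) + ln (2 * P * n + 1))) <=
      q%:R * entropy (J k) (word (s k)) by exact: hent.
  move: h1 h2 h3 h4 h6 h7 h8 avg hent; lra.
have inv_q : \forall q \near \oo, (0 < q)%N by exists 1%N.
apply/ler_addgt0Pl => e e0; have e20 : 0 < e / 2 by rewrite divr_gt0.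
have cvp := partition_entropy_cvg T mT _ letter_cell rho letter_partition inv.
have /cvgrPdist_le/(_ _ e20) near_p := cvp.
have [q [hq q0]] := @filter_ex _ \oo _ _ (filterI near_p inv_q).
have e14 : 0 < e / 14 by rewrite divr_gt0.
have := key q _ q0 e14.
have q1 : q%:R^-1 <= 1 :> R by rewrite invf_le1 ?ltr0n// ler1n.
have : e / 14 * (6 + q%:R^-1) <= e / 14 * (6 + 1) by rewrite ler_pM2l// lerD2l.
move: hq; rewrite ler_norml => /andP[hq _].
lra.
Qed.

End equilibria.

(** * Mixtures and convex hulls *)

Section mixture.
Context {d : measure_display} {X : measurableType d} {R : realType}.

Lemma state_mix (J1 J2 : (X -> R) -> R) (t : R) : 0 <= t <= 1 ->
  state J1 -> state J2 -> state (fun f => t * J1 f + (1 - t) * J2 f).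
Proof.
move=> /andP[t0 t1] h1 h2; have t'0 : 0 <= 1 - t by rewrite subr_ge0.
split.
- by rewrite (state1 _ h1) (state1 _ h2); lra.
- by move=> f g mf mg; rewrite (stateD _ h1)// (stateD _ h2)//; lra.
- by move=> c f mf; rewrite (stateZ _ h1)// (stateZ _ h2)//; lra.
- move=> f g mf mg fg; apply: lerD; apply: ler_wpM2l => //.
    exact: (state_le _ h1).
  exact: (state_le _ h2).
Qed.

Definition mixture (t u : {nonneg R}) (tu : t%:num + u%:num = 1)
    (rho1 rho2 : probability X R) : set X -> \bar R :=
  measure_add (mscale t rho1) (mscale u rho2).

Section mixture_probability.
Variables (t u : {nonneg R}) (tu : t%:num + u%:num = 1).
Variables rho1 rho2 : probability X R.

HB.instance Definition _ := Measure.on (mixture t u tu rho1 rho2).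

Let mixtureT : mixture t u tu rho1 rho2 setT = 1%E.
Proof.
rewrite /mixture measure_addE.
transitivity (t%:num%:E * rho1 setT + u%:num%:E * rho2 setT)%E => //.
by rewrite (probability_setT rho1) (probability_setT rho2) !mule1 -EFinD tu.
Qed.

HB.instance Definition _ := Measure_isProbability.Build _ _ _
  (mixture t u tu rho1 rho2) mixtureT.
End mixture_probability.

Lemma exists_mixture (rho1 rho2 : probability X R) (t : R) : 0 <= t <= 1 ->
  exists rho : probability X R, forall A, measurable A ->
    rho A = (t%:E * rho1 A + (1 - t)%:E * rho2 A)%E.
Proof.
move=> /andP[t0 t1]; have t'0 : 0 <= 1 - t by rewrite subr_ge0.
have tu : (NngNum t0)%:num + (NngNum t'0)%:num = 1 by rewrite /= subrKC.
exists (mixture _ _ tu rho1 rho2) => A mA.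
by rewrite /= /mixture measure_addE.
Qed.

End mixture.

Lemma mixture_integral (R : realType) m (rho rho1 rho2 : probability (Omega m) R)
    (t : R) (f : Omega m -> R) : 0 <= t <= 1 ->
  (forall A, measurable A -> rho A = (t%:E * rho1 A + (1 - t)%:E * rho2 A)%E) ->
  continuous f ->
  \int[rho]_x f x = t * \int[rho1]_x f x + (1 - t) * \int[rho2]_x f x.
Proof.
move=> t01 rhoE cf.
have hS := state_mix _ _ t t01 (state_prob rho1) (state_prob rho2).
apply: (state_eq_continuous _ _ f (state_prob rho) hS) => // N w.
have mw := @measurable_word m N.
rewrite /law !label_prob// rhoE; last exact: mw.
rewrite fineD ?fineM ?fin_numM ?fin_num_measure//; exact: mw.
Qed.

Section hull.
Context {R : realType} {m : nat}.
Local Notation prob := (probability (Omega m) R).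

Lemma convex_hull_mem (S : set prob) rho : S rho -> convex_hull S rho.
Proof.
move=> Srho; exists 1%N, (fun=> 1), (fun=> rho); split => //.
- by rewrite big_ord1.
- by move=> A mA; rewrite big_ord1 mul1e.
Qed.

Lemma convex_hull_mix (S : set prob) kappa rho t : 0 <= t <= 1 ->
  convex_hull S kappa -> S rho ->
  exists2 kappa', convex_hull S kappa' & forall A, measurable A ->
    kappa' A = (t%:E * rho A + (1 - t)%:E * kappa A)%E.
Proof.
move=> t01 [k [w [r [w0 w1 Sr kE]]]] Srho; have /andP[t0 t1] := t01.
have t'0 : 0 <= 1 - t by rewrite subr_ge0.
have [kappa' E] := exists_mixture rho kappa t t01.
exists kappa' => //.
pose w' (i : 'I_k.+1) := oapp (fun j => (1 - t) * w j) t (unlift ord0 i).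
pose r' (i : 'I_k.+1) := oapp r rho (unlift ord0 i).
exists k.+1, w', r'; split.
- by move=> i; rewrite /w'; case: unliftP => [j _|_]//=; rewrite mulr_ge0.
- rewrite big_ord_recl /w' unlift_none/=.
  by under eq_bigr do rewrite liftK/=; rewrite -mulr_sumr w1; lra.
- move=> i; rewrite /r'; case: unliftP => [j _|_] /=; [exact: Sr|exact: Srho].
- move=> A mA; rewrite E// kE// big_ord_recl /w' /r' unlift_none/=.
  congr (_ + _)%E; under [in RHS]eq_bigr do rewrite liftK/= EFinM -muleA.
  by rewrite ge0_sume_distrr// => i _; rewrite mule_ge0// lee_fin.
Qed.

Lemma continuous_sum (I : Type) (r : seq I) (F : I -> Omega m -> R) :
  (forall i, continuous (F i)) -> continuous (fun x => \sum_(i <- r) F i x).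
Proof.
move=> cF; apply: continuous_big => [|i _]; [exact: add_continuous|exact: cF].
Qed.

(** Separation in the finitely many coordinates [psis], by hand. Take [kappa] in
    the hull nearly closest to [nu], let $a=\nu-\kappa$ be the difference of the
    coordinate vectors and test the hypothesis on $\sum a_\psi\psi$: it yields
    $\rho\in S$ with $a\cdot(\rho-\kappa)\ge|a|^2$. Moving from [kappa] towards
    this $\rho$ by a small [t] shortens the distance by a definite amount unless
    the distance is already 0. *)
Lemma convex_hull_approx (S : set prob) (nu : prob)
    (psis : seq (continuousType (Omega m) R)) (e : R) : 0 < e ->
  (forall psi : Omega m -> R, continuous psi ->
    exists2 rho, S rho & \int[nu]_x psi x <= \int[rho]_x psi x) ->
  exists2 kappa, convex_hull S kappa & forall psi, psi \in psis ->
    `|\int[nu]_x psi x - \int[kappa]_x psi x| < e.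
Proof.
move=> e0 hS; have cpsi (psi : continuousType (Omega m) R) : continuous psi.
  exact: cts_fun.
have mpsi psi := continuous_bounded_measurable _ (cpsi psi).
pose a (kappa : prob) (psi : continuousType (Omega m) R) :=
  \int[nu]_x psi x - \int[kappa]_x psi x.
pose D kappa := \sum_(psi <- psis) a kappa psi ^+ 2.
have D0 kappa : 0 <= D kappa by apply: sumr_ge0 => psi _; exact: sqr_ge0.
have [rho0 Srho0 _] := hS (fun=> 0) (fun x => @cst_continuous _ _ _ x).
pose V := [set D kappa | kappa in convex_hull S].
have infV : has_inf V.
  split; first by exists (D rho0), rho0 => //; exact: convex_hull_mem.
  by exists 0 => _ [kappa _ <-]; exact: D0.
have [infV_small|infV_large] := ltP (inf V) (e ^+ 2).
  have gap : 0 < e ^+ 2 - inf V by rewrite subr_gt0.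
  have [_ [kappa hk <-] kD] := inf_adherent gap infV.
  exists kappa => // psi psiin; rewrite subrKC in kD.
  rewrite -(@ltr_pXn2r _ 2)// ?nnegrE// ?ltW// real_normK ?num_real//.
  apply: le_lt_trans kD; rewrite /D (big_rem psi)//= -/(a kappa psi) lerDl.
  by apply: sumr_ge0 => phi _; exact: sqr_ge0.
set Ds := inf V in infV_large; have Ds0 : 0 < Ds.
  by apply: lt_le_trans infV_large; rewrite exprn_gt0.
have /choice[C hC] : forall psi : continuousType (Omega m) R,
    exists C, forall x, `|psi x| <= C by move=> psi; have [_] := mpsi psi.
pose Lc := \sum_(psi <- psis) (2 * C psi) ^+ 2.
have Lc0 : 0 <= Lc by apply: sumr_ge0 => psi _; exact: sqr_ge0.
have DL : 0 < Ds + Lc by rewrite ltr_wpDr.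
pose t := Ds / (Ds + Lc).
have t0 : 0 < t by rewrite divr_gt0.
have t1 : t <= 1 by rewrite ler_pdivrMr// mul1r lerDl.
have tLc : t * Lc <= Ds.
  by rewrite /t mulrAC ler_pdivrMr// ler_pM2l// lerDr ltW.
have eta0 : 0 < t * Ds / 2 by rewrite divr_gt0// mulr_gt0.
have [_ [kappa hk <-] kD] := inf_adherent eta0 infV.
have Ds_le k' : convex_hull S k' -> Ds <= D k'.
  by move=> hk'; apply: ge_inf; [case: infV|exists k'].
pose psi0 x := \sum_(psi <- psis) a kappa psi * psi x.
have int0 (rho : prob) : \int[rho]_x psi0 x =
    \sum_(psi <- psis) a kappa psi * \int[rho]_x psi x.
  have /= sumE := state_sum _ (state_prob rho).
  rewrite sumE; last by move=> psi; exact/bounded_measurableZ/mpsi.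
  apply: eq_bigr => psi _; have /= ZE := stateZ _ (state_prob rho).
  by rewrite ZE.
have cpsi0 : continuous psi0.
  apply: continuous_sum => psi x.
  by apply: (@continuousM R (Omega m) (fun=> a kappa psi) psi x);
    [exact: cst_continuous|exact: cpsi].
have [rho Srho] := hS psi0 cpsi0; rewrite !int0 => nu_rho.
have t01 : 0 <= t <= 1 by rewrite ltW.
have [kappa' hk' k'E] := convex_hull_mix S kappa rho t t01 hk Srho.
pose b (psi : continuousType (Omega m) R) :=
  \int[rho]_x psi x - \int[kappa]_x psi x.
have Dk' : D kappa' = D kappa - 2 * t * (\sum_(psi <- psis) a kappa psi * b psi) +
    t ^+ 2 * \sum_(psi <- psis) b psi ^+ 2.
  rewrite !mulr_sumr -sumrN -!big_split/=; apply: eq_bigr => psi _.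
  rewrite [a kappa' psi]/a (mixture_integral _ _ _ _ _ _ _ t01 k'E (cpsi psi)).
  by rewrite /a /b; ring.
have bL : \sum_(psi <- psis) b psi ^+ 2 <= Lc.
  apply: ler_sum => psi _; rewrite -ler_sqrt ?sqr_ge0// !sqrtr_sqr.
  rewrite [leRHS]ger0_norm.
    rewrite mulrDl mul1r (le_trans (ler_normB _ _))// lerD//.
      exact: (state_bound _ (state_prob rho) _ _ (mpsi psi) (hC psi)).
    exact: (state_bound _ (state_prob kappa) _ _ (mpsi psi) (hC psi)).
  by rewrite mulr_ge0//; exact: le_trans (normr_ge0 _) (hC psi point).
have ab : D kappa <= \sum_(psi <- psis) a kappa psi * b psi.
  have -> : \sum_(psi <- psis) a kappa psi * b psi =
      \sum_(psi <- psis) a kappa psi * \int[rho]_x psi x -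
      \sum_(psi <- psis) a kappa psi * \int[kappa]_x psi x.
    by rewrite -sumrB; apply: eq_bigr => psi _; rewrite -mulrBr.
  have -> : D kappa = \sum_(psi <- psis) a kappa psi * \int[nu]_x psi x -
      \sum_(psi <- psis) a kappa psi * \int[kappa]_x psi x.
    by rewrite -sumrB; apply: eq_bigr => psi _; rewrite -mulrBr expr2.
  by rewrite lerD2r.
have k'_ge := Ds_le _ hk'; have k_ge := Ds_le _ hk.
have e1 : t * D kappa <= t * \sum_(psi <- psis) a kappa psi * b psi.
  by rewrite ler_pM2l.
have e2 : t ^+ 2 * \sum_(psi <- psis) b psi ^+ 2 <= t * Ds.
  rewrite expr2 -mulrA ler_pM2l//; apply: le_trans tLc; rewrite ler_pM2l//.
have e3 : t * Ds <= t * D kappa by rewrite ler_pM2l.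
have tD : 0 < t * Ds by rewrite mulr_gt0.
exfalso; move: k'_ge kD; rewrite Dk' -/Ds => k'_ge kD.
suff : t * Ds / 2 < 0 by rewrite ltNge ltW.
lra.
Qed.

End hull.

(** * Weak-star closure, invariance and ergodicity *)

Section weak_star_closure.
Context {R : realType} {m : nat}.
Local Notation C := (continuousType (Omega m) R).

(** The sets of functions close to [f] at finitely many points form a filter that
    converges to [f] in each coordinate, hence in the product topology. *)
Lemma nbhs_pointwise (f : {ptws C -> R}) (O : set {ptws C -> R}) : nbhs f O ->
  exists (psis : seq C) (e : R), 0 < e /\
    forall h : {ptws C -> R}, (forall psi, psi \in psis -> `|f psi - h psi| < e) -> O h.
Proof.
move=> fO.
pose F : set_system {ptws C -> R} :=
  filter_from [set p : seq C * R | 0 < p.2]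
    (fun p => [set h | forall psi, psi \in p.1 -> `|f psi - h psi| < p.2]).
have FF : Filter F.
  apply: filter_from_filter; first by exists ([::], 1) => /=.
  move=> [s e] [s' e'] /= e0 e'0; exists (s ++ s', Num.min e e') => /=.
    by rewrite lt_min e0.
  move=> h /= hh; split => psi ps; have := hh psi; rewrite mem_cat ps ?orbT;
    by move=> /(_ isT); rewrite lt_min => /andP[].
suff : F --> f by move=> /(_ _ fO)[[s e] /= e0 H]; exists s, e.
apply/cvg_sup => psi B [_ [[V oV <-] Vf VB]].
have /nbhs_ballP[e /= e0 eV] : nbhs (f psi) V by apply: open_nbhs_nbhs.
exists ([:: psi], e) => //= h hh; apply: VB; apply: eV.
by apply: hh; rewrite mem_head.
Qed.

Lemma mem_closed_convex_hull (S : set (probability (Omega m) R))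
    (nu : probability (Omega m) R) :
  (forall (psis : seq C) (e : R), 0 < e ->
    exists2 kappa, convex_hull S kappa & forall psi, psi \in psis ->
      `|\int[nu]_x psi x - \int[kappa]_x psi x| < e) ->
  closed_convex_hull S nu.
Proof.
move=> h B; rewrite nbhsE => -[U [Uo nuU] UB]; have [W open_W WU] := Uo.
have nuO : nbhs (expectation_on_C nu) W.
  by apply: open_nbhs_nbhs; split => //; move: nuU; rewrite -WU.
have [psis [e [e0 eO]]] := nbhs_pointwise _ _ nuO.
have [kappa hk kappa_e] := h psis e e0; exists kappa; split => //.
by apply: UB; rewrite -WU; exact: eO.
Qed.

End weak_star_closure.

Section mean_field_equilibria.
Context {R : realType} {m : nat}.
Local Notation T := (@left_shift m).
Variable mu : probability (Omega m) R.
Variables (g : Omega m -> R) (beta : R).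
Hypotheses (cg : continuous g).

(** Composing [f] with the shift changes its averages over $n$ steps by
    $O(1/n)$. *)
Lemma mean_field_invariant (nu : probability (Omega m) R) :
  mean_field_equilibrium mu g beta nu -> invariant_prob T nu.
Proof.
move=> [s hs cvs]; apply: invariant_of_continuous => f cf.
have mT := @measurable_left_shift m.
have mf := continuous_bounded_measurable f cf; have [_ [C fC]] := mf.
have mg := continuous_bounded_measurable g cg.
have cv := mean_field_equilibrium_cvg mu g beta nu s f cf cvs.
have cvT := mean_field_equilibrium_cvg mu g beta nu s _
  (continuous_comp_shift R m f cf) cvs.
apply/eqP; rewrite -subr_eq0 -normr_le0; apply/ler_addgt0Pl => e e0.
rewrite addr0.
set u := (fun k => _) in cvT; set v := (fun k => _) in cv.
have cvd : `|u k - v k| @[k --> \oo] -->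
    `|\int[nu]_x f (left_shift x) - \int[nu]_x f x|.
  by apply: cvg_norm; apply: cvgB.
apply: (@ler_cvg_to _ _ _ R _ (fun=> e) _ _ cvd (@cvg_cst _ _ _ _ _)).
have : \forall k \near \oo, (0 < s k)%N /\ 2 * C <= (s k)%:R * e.
  apply: (near_infty_seq s (fun n => (0 < n)%N /\ 2 * C <= n%:R * e)) => //.
  have [n0 hn0] := natr_unbounded R (2 * C) e e0.
  exists (maxn 1 n0) => n; rewrite geq_max => /andP[n0' /hn0 h].
  by split.
apply: filterS => k [k0 hk] /=.
pose E x := beta * (s k)%:R / 2 * birkhoff T g (s k) x ^+ 2.
have mE : bounded_measurable E.
  apply: bounded_measurableZ; have mb := bounded_measurable_birkhoff T g (s k) mT mg.
  exact: (bounded_measurableM _ _ mb mb).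
have hJ := state_density mu _ (bounded_measurable_expR _ mE)
  (fun x => expR_ge0 _) (expR_integral_gt0 mu E mE).
apply: (le_trans (state_birkhoff_shift T mT _ f C (s k) hJ k0 mf fC)).
by rewrite ler_pdivrMr ?ltr0n// [leRHS]mulrC.
Qed.

End mean_field_equilibria.

Section ergodicity.
Context {R : realType} {m : nat}.
Local Notation T := (@left_shift m).
Local Notation prob := (probability (Omega m) R).
Let mT := @measurable_left_shift m.

Lemma conditional_prob (rho : prob) (A : set (Omega m)) : measurable A ->
  rho A <> 0%E ->
  exists rhoA : prob, forall B, measurable B ->
    rhoA B = (rho (B `&` A) * (fine (rho A))^-1%:E)%E.
Proof.
move=> mA A0; exists (mnormalize (mrestr rho mA) rho) => B mB.
have E : mrestr rho mA setT = rho A by rewrite /mrestr setTI.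
rewrite /= /mnormalize /= E; case: ifPn => // /orP[/eqP//|/eqP Aoo].
by have /fin_numP[_ /eqP/(_ Aoo)] := fin_num_measure rho A mA.
Qed.

Lemma partition_entropy_mix (rho rho1 rho2 : prob) (t : R) k
    (P : 'I_k -> set (Omega m)) : 0 < t < 1 ->
  (forall A, measurable A -> rho A = (t%:E * rho1 A + (1 - t)%:E * rho2 A)%E) ->
  invariant_prob T rho -> invariant_prob T rho1 -> invariant_prob T rho2 ->
  measurable_partition P ->
  partition_entropy T rho P <= t * partition_entropy T rho1 P +
    (1 - t) * partition_entropy T rho2 P.
Proof.
move=> t01 rhoE inv inv1 inv2 pP; set c := - (t * ln t + (1 - t) * ln (1 - t)).
have [alpha ma PE] := partition_label _ _ pP.
have join_le n : join_entropy T rho P n <= t * join_entropy T rho1 P n +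
    (1 - t) * join_entropy T rho2 P n + c.
  rewrite !(join_entropyE T mT _ k P alpha n ma PE).
  have mb := measurable_label_block T alpha n mT ma.
  apply: entropy_mix => //.
  - by move=> a; exact: (law_ge0 _ (state_prob rho1)).
  - by move=> a; exact: (law_ge0 _ (state_prob rho2)).
  - exact: (sum_law _ (state_prob rho1)).
  - exact: (sum_law _ (state_prob rho2)).
  - move=> a; rewrite /law !label_prob// rhoE; last exact: mb.
    rewrite fineD ?fineM ?fin_numM ?fin_num_measure//; exact: mb.
have cv := partition_entropy_cvg T mT k P rho pP inv.
have cv1 := partition_entropy_cvg T mT k P rho1 pP inv1.
have cv2 := partition_entropy_cvg T mT k P rho2 pP inv2.
have cvc : n%:R^-1 * c @[n --> \oo] --> (0 : R).
  apply/cvgrPdist_le => e e0.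
  have [n0 hn0] := natr_unbounded R `|c| e e0.
  exists (maxn 1 n0) => // n /=; rewrite geq_max => /andP[n1 /hn0 cn].
  rewrite sub0r normrN normrM ger0_norm ?invr_ge0//.
  by rewrite ler_pdivrMl ?ltr0n.
have cvr : t * (n%:R^-1 * join_entropy T rho1 P n) +
    (1 - t) * (n%:R^-1 * join_entropy T rho2 P n) + n%:R^-1 * c @[n --> \oo] -->
    t * partition_entropy T rho1 P + (1 - t) * partition_entropy T rho2 P + 0.
  by apply: cvgD => //; apply: cvgD; apply: cvgMr.
rewrite -[leRHS]addr0; apply: ler_cvg_to cv cvr _.
apply: nearW => n; rewrite mulrCA [(1 - t) * (_ * _)]mulrCA -!mulrDr.
by rewrite ler_wpM2l ?invr_ge0.
Qed.

(** Conditioning on a nontrivial invariant set [A] and on its complement writes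
    [rho] as a mixture of two invariant probabilities. Entropy being affine and the
    square convex, [rho] has at most the average of their free energies, so both
    are maximizers; but they differ on [A]. *)
Lemma unique_maximizer_ergodic (g : Omega m -> R) (beta : R) (rho : prob) :
  continuous g -> 0 < beta -> letter_maximizer g beta rho ->
  (forall rho', letter_maximizer g beta rho' ->
    forall A, measurable A -> rho' A = rho A) ->
  ergodic_prob T rho.
Proof.
move=> cg beta0 [inv rho_max] uniq A mA TA.
have [A0|A0] := pselect (rho A = 0%E); first by left.
right; apply: contrapT => A1.
set t := fine (rho A).
have tE : rho A = t%:E by rewrite fineK// fin_num_measure.
have mAc : measurable (~` A) by exact: measurableC.
have Ac : rho (~` A) = (1 - t)%:E by rewrite probability_setC// tE.
have t0 : 0 < t.
  rewrite lt_def; apply/andP; split; first by apply/eqP => t0; apply: A0; rewrite tE t0.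
  by rewrite -lee_fin -tE.
have t1 : t < 1.
  rewrite lt_neqAle; apply/andP; split; first by apply/eqP => t1; apply: A1; rewrite tE t1.
  by rewrite -lee_fin -tE probability_le1.
have Ac0 : rho (~` A) <> 0%E by rewrite Ac => -[]; lra.
have [rho1 rho1E] := conditional_prob rho A mA A0.
have [rho2 rho2E] := conditional_prob rho (~` A) mAc Ac0.
have cond_inv (B : set (Omega m)) (rhoB : prob) : T @^-1` B = B -> measurable B ->
    (forall D, measurable D -> rhoB D = (rho (D `&` B) * (fine (rho B))^-1%:E)%E) ->
    invariant_prob T rhoB.
  move=> TB mB rhoBE D mD.
  have mTD : measurable (T @^-1` D) by rewrite -[_ @^-1` _]setTI; exact: mT.
  rewrite !rhoBE// -[in LHS]TB -preimage_setI inv//; first by rewrite TB.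
  exact: measurableI.
have inv1 : invariant_prob T rho1 by exact: (cond_inv A).
have inv2 : invariant_prob T rho2.
  by apply: (cond_inv (~` A)) => //; rewrite -preimage_setC TA.
have rhoE B : measurable B -> rho B = (t%:E * rho1 B + (1 - t)%:E * rho2 B)%E.
  move=> mB; rewrite rho1E// rho2E// Ac tE/= muleCA [((1 - t)%:E * _)%E]muleCA.
  rewrite -!EFinM !divff ?gt_eqF ?subr_gt0// !mule1 -measureU.
  - by rewrite -setIUr setUv setIT.
  - exact: measurableI.
  - exact: measurableI.
  - by rewrite setIACA setICr setI0.
have t01 : 0 < t < 1 by rewrite t0.
have t01' : 0 <= t <= 1 by rewrite !ltW.
have int_g := mixture_integral R m rho rho1 rho2 t g t01' rhoE cg.
have pe := partition_entropy_mix rho rho1 rho2 t _ _ t01 rhoE inv inv1 inv2 letter_partition.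
have max1 := rho_max rho1 _ _ inv1 letter_partition.
have max2 := rho_max rho2 _ _ inv2 letter_partition.
have sq : (\int[rho]_x g x) ^+ 2 <= t * (\int[rho1]_x g x) ^+ 2 +
    (1 - t) * (\int[rho2]_x g x) ^+ 2.
  rewrite int_g -subr_ge0; set a := Rintegral _ _ _; set b := Rintegral _ _ _.
  rewrite (_ : _ - _ = t * (1 - t) * (a - b) ^+ 2); last by ring.
  by rewrite mulr_ge0 ?sqr_ge0// mulr_ge0 ?subr_ge0 ?ltW.
have bsq : beta / 2 * (\int[rho]_x g x) ^+ 2 <=
   t * (beta / 2 * (\int[rho1]_x g x) ^+ 2) +
   (1 - t) * (beta / 2 * (\int[rho2]_x g x) ^+ 2).
  have b2 : 0 <= beta / 2 by rewrite divr_ge0// ltW.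
  by have := ler_wpM2l b2 sq; lra.
have max_rho1 : letter_maximizer g beta rho1.
  split => // nu k P inu pP; apply: le_trans (rho_max nu k P inu pP) _.
  set F := partition_entropy T rho _ + _ in max1 max2 *.
  set F1 := partition_entropy T rho1 _ + _ in max1 *.
  set F2 := partition_entropy T rho2 _ + _ in max2.
  have FF : F <= t * F1 + (1 - t) * F2 by rewrite /F /F1 /F2 !mulrDr; lra.
  have : (1 - t) * F2 <= (1 - t) * F by rewrite ler_pM2l// subr_gt0.
  by move=> F2F; rewrite -(ler_pM2l t0); lra.
have := uniq rho1 max_rho1 A mA; rewrite rho1E// setIid tE/= -EFinM.
by rewrite divff ?gt_eqF// => -[t1']; move: t1; rewrite -t1' ltxx.
Qed.

End ergodicity.

(** * The theorem *)

Theorem theorem6p1 (R : realType) (m : nat) (mu : probability (Omega m) R)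
    (g : Omega m -> R) (beta : R)
    (hmu : uniform_product mu) (hg : hoelder_continuous g) (hbeta : 0 < beta) :
  (forall nu : probability (Omega m) R,
     mean_field_equilibrium mu g beta nu ->
     invariant_prob (@left_shift m) nu /\
     closed_convex_hull (quadratic_equilibrium g beta) nu) /\
  ((exists nu : probability (Omega m) R,
      mean_field_equilibrium mu g beta nu /\ ~ ergodic_prob (@left_shift m) nu) ->
   nonlinear_phase_transition g beta).
Proof.
have cg := hoelder_continuousW g hg.
have maxP := exists_maximizer_ge mu hmu g beta cg hbeta.
split=> [nu hnu|[nu [hnu nu_erg]]].
  split; first exact: mean_field_invariant hnu.
  apply: mem_closed_convex_hull => psis e e0.
  apply: (convex_hull_approx _ nu psis e e0) => psi cpsi.
  have [rho rho_max nu_rho] := maxP nu psi hnu cpsi.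
  by exists rho => //; exact: letter_maximizer_equilibrium.
apply: contrapT => no_transition.
have uniq rho1 rho2 : letter_maximizer g beta rho1 -> letter_maximizer g beta rho2 ->
    forall A, measurable A -> rho1 A = rho2 A.
  move=> h1 h2 A mA; apply: contrapT => neq; apply: no_transition.
  by exists rho1, rho2; split; [exact: letter_maximizer_equilibrium..|exists A].
have [rho rho_max _] := maxP nu (fun=> 0) hnu (fun x => @cst_continuous _ _ _ x).
have int_uniq rho' (psi : Omega m -> R) : letter_maximizer g beta rho' ->
    \int[rho']_x psi x = \int[rho]_x psi x.
  move=> h; rewrite /Rintegral; congr fine; apply: eq_measure_integral => A mA _.
  exact: uniq.
have nuE : forall A, measurable A -> nu A = rho A.
  apply: probability_unique => psi cpsi; apply/eqP; rewrite eq_le; apply/andP; split.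
    have [rho' h' le'] := maxP nu psi hnu cpsi.
    by rewrite -(int_uniq rho').
  pose npsi x := 0 * psi x + -1 * psi x.
  have cn : continuous npsi by exact: continuous_lincomb.
  have [rho' h' le'] := maxP nu npsi hnu cn.
  have mpsi := continuous_bounded_measurable _ cpsi.
  have intN (q : probability (Omega m) R) : \int[q]_x npsi x = - \int[q]_x psi x.
    have hq := state_prob q; rewrite /npsi.
    have -> : (fun x => 0 * psi x + -1 * psi x) = (fun x => -1 * psi x).
      by apply/funext => x; rewrite mul0r add0r.
    by rewrite (stateZ _ hq)// mulN1r.
  by move: le'; rewrite !intN lerN2 int_uniq.
apply: nu_erg => A mA TA; rewrite nuE//.
by apply: (unique_maximizer_ergodic g beta rho cg hbeta rho_max) => // rho' h'; exact: uniq.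
Qed.
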